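(* For each $N\in\mathbb N$ let $(\mathcal A_N,\varphi_N,\rho_N)$ be a second order non-commutative probability space, and let unital subalgebras $\mathcal A_N^1,\dots,\mathcal A_N^N\subset\mathcal A_N$ be given which are free with respect to $(\varphi_N,\rho_N)$. Let $T$ be an index set and assume that for each $t\in T$ and each $N\in\mathbb N$ we have elements $q_N^i(t)\in\mathcal A_N^i$ ($i=1,\dots,N$) such that: (a) The distribution of the $q_N^i(t)$ under $(\varphi_N,\rho_N)$ is invariant under permutations of the upper indices: for all $N$, all permutations $\pi$ of $[1,N]$, all $n,m\in\mathbb N$, $t_1,\dots,t_{n+m}\in T$ and $i(1),\dots,i(n+m)\in[1,N]$, $$\varphi_N\big(q_N^{i(1)}(t_1)\cdots q_N^{i(n)}(t_n)\big)=\varphi_N\big(q_N^{\pi(i(1))}(t_1)\cdots q_N^{\pi(i(n))}(t_n)\big)$$ and $$\rho_N\big(q_N^{i(1)}(t_1)\cdots q_N^{i(n)}(t_n),\,q_N^{i(n+1)}(t_{n+1})\cdots q_N^{i(n+m)}(t_{n+m})\big)=\rho_N\big(q_N^{\pi(i(1))}(t_1)\cdots q_N^{\pi(i(n))}(t_n),\,q_N^{\pi(i(n+1))}(t_{n+1})\cdots q_N^{\pi(i(n+m))}(t_{n+m})\big).$$ (b) For all $n,m\in\mathbb N$ and all $t_1,\dots,t_{n+m}\in T$ there exist constants $\check\psi_1(t_1,\dots,t_n)$ and $\check\psi_2(t_1,\dots,t_n;t_{n+1},\dots,t_{n+m})$ such that $$\lim_{N\to\infty}N\cdot\varphi_N\big(q_N^i(t_1)\cdots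 q_N^i(t_n)\big)=\check\psi_1(t_1,\dots,t_n),$$ $$\lim_{N\to\infty}N\cdot\rho_N\big(q_N^i(t_1)\cdots q_N^i(t_n),\,q_N^i(t_{n+1})\cdots q_N^i(t_{n+m})\big)=\check\psi_2(t_1,\dots,t_n;t_{n+1},\dots,t_{n+m})$$ (by (a) the left-hand sides do not depend on $i$). For $t\in T$ and $N\in\mathbb N$ let $S_N(t):=q_N^1(t)+\cdots+q_N^N(t)\in\mathcal A_N$. Then for all $n,m\ge1$ and $t_1,\dots,t_{n+m}\in T$, $$\lim_{N\to\infty}\rho_N\big(S_N(t_1)\cdots S_N(t_n),\,S_N(t_{n+1})\cdots S_N(t_{n+m})\big)=\sum_{\sigma\in NC(n,m)}\check\psi_\sigma(t_1,\dots,t_n;t_{n+1},\dots,t_{n+m}).$$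
   Context: A second order non-commutative probability space $(\mathcal A,\varphi,\rho)$ consists of a unital complex algebra $\mathcal A$, a tracial linear functional $\varphi:\mathcal A\to\mathbb C$ with $\varphi(1)=1$, and a bilinear functional $\rho:\mathcal A\times\mathcal A\to\mathbb C$, tracial in each argument, with $\rho(a,1)=0=\rho(1,b)$ for all $a,b\in\mathcal A$. Given unital subalgebras $\mathcal A_1,\dots,\mathcal A_r\subset\mathcal A$, a tuple $(a_1,\dots,a_n)$ ($n\ge1$) is cyclically alternating if for each $k$ there is $i(k)\in\{1,\dots,r\}$ with $a_k\in\mathcal A_{i(k)}$ and, if $n\ge2$, $i(k)\ne i(k+1)$ for $k=1,\dots,n$ (indices modulo $n$, so $i(n)\neq i(1)$). It is centered if $\varphi(a_k)=0$ for all $k$. The subalgebras are free with respect to $(\varphi,\rho)$ (free of second order) if they are free with respect to $\varphi$ (in Voiculescu's sense) and for all centered and cyclically alternating tuples $(a_1,\dots,a_n)$, $(b_1,\dots,b_m)$: (i) $\rho(a_1\cdots a_n,b_1\cdots b_m)=0$ for $n\ne m$; (ii) $\rho(a,b)=0$ for $a\in\mathcal A_i$, $b\in\mathcal A_j$, $i\ne j$; (iii) if $n=m\ge2$, $\rho(a_1\cdots a_n,b_1\cdots b_n)=\sum_{k=0}^{n-1}\varphi(a_1b_{n+k})\varphi(a_2b_{(n-1)+k})\cdots\varphi(a_nb_{1+k})$ (indices of $b$ modulo $n$). Annular non-crossing partitions $NC(n,m)$: put $1,\dots,n$ with its cyclic order on one circle and $n+1,\dots,n+m$ with its cyclic order on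 the other. A partition $\sigma$ of $[1,n+m]$ is tested recursively: if $\sigma$ has a block contained in $[1,n]$ or in $[n+1,n+m]$ which consists of cyclically consecutive numbers, remove this block (the remaining points keep their cyclic orders) and repeat, until a partition $\sigma'$ on $n'+m'$ points without such blocks is reached. Then $\sigma\in NC(n,m)$ iff $n',m'\ge1$ and $\sigma'$ satisfies: each block $B$ of $\sigma'$ has non-empty intersections $B'$ with the first and $B''$ with the second circle, each of which consists of cyclically consecutive points (among the remaining ones), and the cyclic order of the $B'$ along the first circle $(1,\dots,n)$ is the reverse of the cyclic order of the $B''$ along the second circle $(n+1,\dots,n+m)$. A through-block of $\sigma$ is a block meeting both $[1,n]$ and $[n+1,n+m]$. Cyclic order on blocks: a block contained in one circle gets the induced cyclic order. If $\sigma$ has more than one through-block, then for each through-block $B$ the sets $B'=B\cap[1,n]$, $B''=B\cap[n+1,n+m]$ are arcs that are consecutive among the points lying in through-blocks of the respective circle, so each has a well-defined first and last element with respect to the cyclic orders $(1,\dots,n)$ and $(n+1,\dots,n+m)$; the cyclic order on $B$ is: run through $B'$ from first to last, then through $B''$ from first to last, and return to the first element of $B'$. Definition of $\check\psi_\sigma$: for $\sigma\in NC(n,m)$ put $\check\psi_\sigma(t_1,\dots,t_n;t_{n+1},\dots,t_{n+m})=\prod_{B\in\sigma}\check\psi_B$, where: if $B$ is not the only through-block of $\sigma$, write it as a cycle $(i(1),\dots,i(k))$, using the cyclic order induced from its circle if $B$ is contained in one circle, and, if $B$ is one of several through-blocks, using the cyclic order which runs through $B'=B\cap[1,n]$ from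 its first to its last element, then through $B''=B\cap[n+1,n+m]$ from its first to its last element, and returns to the first element of $B'$; then put $\check\psi_B=\check\psi_1(t_{i(1)},\dots,t_{i(k)})$; if $B$ is the only through-block of $\sigma$, write $B\cap[1,n]=(i(1),\dots,i(k))$ and $B\cap[n+1,n+m]=(j(1),\dots,j(l))$ with the induced cyclic orders and put $\check\psi_B=\check\psi_2(t_{i(1)},\dots,t_{i(k)};t_{j(1)},\dots,t_{j(l)})$. (This is well defined as $\check\psi_1$ is invariant under cyclic rotation of its arguments, and $\check\psi_2$ under cyclic rotation of each group of arguments.) *)

(* Defs.v *)
From mathcomp Require Import all_boot all_order all_algebra all_fingroup.
From mathcomp Require Import complex.

Set Implicit Arguments.
Unset Strict Implicit.
Unset Printing Implicit Defensive.

Import GRing.Theory.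

Local Open Scope ring_scope.
Local Open Scope complex_scope.

Record second_order_space (R : rcfType) := SecondOrderSpace {
  carrier :> algType R[i];
  phi : {scalar carrier};
  rho : {biscalar carrier};
  phi_tracial : forall a b : carrier, phi (a * b) = phi (b * a);
  phi_unit : phi 1 = 1;
  rho_traciall : forall a a' b : carrier, rho (a * a') b = rho (a' * a) b;
  rho_tracialr : forall a b b' : carrier, rho a (b * b') = rho a (b' * b);
  rho_unitr : forall a : carrier, rho a 1 = 0;
  rho_unitl : forall b : carrier, rho 1 b = 0 }.

Arguments phi {R s}.
Arguments rho {R s}.

Section Freeness.

Variables (R : rcfType) (A : second_order_space R) (r : nat).
Variable S : 'I_r -> {pred A}.

Definition centered n (a : 'I_n -> A) : Prop := forall k, phi (a k) = 0.

Definition cyclically_alternating n (a : 'I_n -> A) : Prop :=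
  (0 < n)%N /\
  exists i : 'I_n -> 'I_r,
    (forall k, a k \in S (i k)) /\
    ((1 < n)%N -> forall k, i k != i (ordS k)).

Definition free_first_order : Prop :=
  forall n (a : 'I_n -> A) (i : 'I_n -> 'I_r),
    (0 < n)%N -> (forall k, a k \in S (i k)) -> centered a ->
    (forall k l : 'I_n, l = k.+1 :> nat -> i k != i l) ->
    phi (\prod_(k < n) a k) = 0.

(* In the last clause indices are shifted to start at 0: [b_(n+1-j+k)] becomes
   [b] at [(n - 1 - j) + k] modulo [n]. *)
Definition free_second_order : Prop :=
  [/\ free_first_order,
      forall n m (a : 'I_n -> A) (b : 'I_m -> A),
        centered a -> cyclically_alternating a ->
        centered b -> cyclically_alternating b ->
        n <> m -> rho (\prod_(j < n) a j) (\prod_(j < m) b j) = 0,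
      forall (i j : 'I_r) (a b : A),
        a \in S i -> b \in S j -> i != j -> rho a b = 0
    & forall n (a b : 'I_n -> A),
        centered a -> cyclically_alternating a ->
        centered b -> cyclically_alternating b ->
        (1 < n)%N ->
        rho (\prod_(j < n) a j) (\prod_(j < n) b j) =
        \sum_(k < n) \prod_(j < n) phi (a j * b (iter k (@ordS n) (rev_ord j)))].

End Freeness.

Section AnnularPartitions.

Variables n m : nat.
Implicit Types (x : 'I_(n + m)) (B C D : {set 'I_(n + m)}).
Implicit Types P Q sigma : {set {set 'I_(n + m)}}.

Definition circle1 : {set 'I_(n + m)} := [set x : 'I_(n + m) | (x < n)%N].
Definition circle2 : {set 'I_(n + m)} := [set x : 'I_(n + m) | (n <= x)%N].

(* For [D] inside one circle, the list [enum D] is increasing; read cyclically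
   it is the induced cyclic order on [D]. *)
Definition consecutive D B : bool :=
  [exists r : 'I_#|D|.+1, B == [set:: take #|B| (rot r (enum D))]].

(* A partially reduced partition is its set of remaining blocks, so that
   [cover P] is the set of remaining points. *)
Definition removable P B : bool :=
  ((B \subset circle1) && consecutive (cover P :&: circle1) B) ||
  ((B \subset circle2) && consecutive (cover P :&: circle2) B).

Definition remove_block P Q : bool :=
  [exists B in P, removable P B && (Q == P :\ B)].

(* When the blocks of [P] meet [C] in arcs, this lists them in cyclic order
   along [C]: only one arc can be split between the two ends of the list of
   points, and keeping one of its two occurrences does not change the order. *)
Definition blocks_along P C : seq {set 'I_(n + m)} :=
  undup [seq pblock P x | x <- enum (cover P :&: C)].

Definition irreducible_annular P : bool :=
  [&& [forall B in P, ~~ removable P B],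
      cover P :&: circle1 != set0,
      cover P :&: circle2 != set0,
      [forall B in P,
        [&& B :&: circle1 != set0, B :&: circle2 != set0,
            consecutive (cover P :&: circle1) (B :&: circle1)
          & consecutive (cover P :&: circle2) (B :&: circle2)]]
    & [exists r : 'I_#|P|.+1,
        blocks_along P circle1 == rot r (rev (blocks_along P circle2))]].

Definition NC : {set {set {set 'I_(n + m)}}} :=
  [set sigma | partition sigma [set: 'I_(n + m)] &
     [exists P, connect remove_block sigma P && irreducible_annular P]].

Definition is_through B : bool :=
  (B :&: circle1 != set0) && (B :&: circle2 != set0).

Definition through_blocks sigma := [set B in sigma | is_through B].

(* The points of [B] from first to last, for a proper arc [B] of the cyclically
   ordered set [D]; the first point is the one whose predecessor in [D] is
   outside [B]. *)
Definition from_first D B : seq 'I_(n + m) :=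
  let s := enum D in
  [seq x <- rot (find [pred x in B | prev s x \notin B] s) s | x \in B].

Definition through_cycle sigma B : seq 'I_(n + m) :=
  let D := cover (through_blocks sigma) in
  from_first (D :&: circle1) (B :&: circle1) ++
  from_first (D :&: circle2) (B :&: circle2).

Section Weights.

Variables (K : comNzRingType) (T : Type).
Variables (psi1 : seq T -> K) (psi2 : seq T -> seq T -> K).
Variable t : 'I_(n + m) -> T.

Definition psi_block sigma B : K :=
  if ~~ is_through B then psi1 [seq t x | x <- enum B]
  else if #|through_blocks sigma| == 1%N then
    psi2 [seq t x | x <- enum (B :&: circle1)]
         [seq t x | x <- enum (B :&: circle2)]
  else psi1 [seq t x | x <- through_cycle sigma B].

Definition psi_partition sigma : K := \prod_(B in sigma) psi_block sigma B.

End Weights.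

End AnnularPartitions.

(* Main.v *)
Require Import Defs.
From mathcomp Require Import all_boot all_order all_algebra all_fingroup.
From mathcomp Require Import complex zify ring.
From mathcomp Require Import boolp classical_sets reals topology normedtype.
From mathcomp Require Import sequences.

(** The product of the sums is a sum over all index functions
    $i : [1, n+m] \to [1, N]$.  By permutation invariance a term only depends
    on the kernel of $i$, a partition $\sigma$, and $N(N-1)\cdots(N-|\sigma|+1)$
    functions have this kernel ([card_kernel], [same_kernel_perm]).  So it is
    enough to show that $N^{|\sigma|}$ times the term of $\sigma$ tends to
    $\check\psi_\sigma$ if $\sigma$ is annular non-crossing, and to 0 otherwise.

    The letters of each circle fall into runs of cyclically adjacent letters
    with the same index, that is, from the same subalgebra.  For an induction
    the two words are restricted to a set $D$ of positions ([corr]), with one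
    factor $N$ for each class of the kernel that meets $D$ ([corr_limit]).

    If a class is an arc of one circle, it is a single run, and it factors out
    exactly: $\rho$ of the words is $\varphi$ of the run times $\rho$ of the words
    without it ([corr_arc]).  On the side of partitions this is the removal of a
    block.  Removals commute ([removable_remove]), so that the outcome of the
    reduction does not depend on their order ([annular_remove]).

    If no class is an arc, each class is spread over at least two runs.  Write
    each run as its expectation plus a centred element.  A term in which some
    runs are replaced by their expectations, which are $O(1/N)$, contains more
    of these small factors than it loses classes ([card_classes_drop]), so it
    vanishes in the limit ([drop_limit]), and only the product of the centred
    runs is left.  To this product second order freeness applies: it gives a
    sum over the rotations that match the runs of the first circle with the runs
    of the second one in reverse order.  A matching survives if and only if
    matched runs have equal labels and there are as many classes as pairs, which
    says that the partition is irreducible annular with these pairs as its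
    blocks ([irreducible_matched], [matched_irreducible]).  Each pair then
    contributes $\check\psi_1$ of its two arcs in succession
    ([centered_pair_limit], [matched_weight]).  The case of a single class on
    both circles is the definition of $\check\psi_2$. *)

Set Implicit Arguments.
Unset Strict Implicit.
Unset Printing Implicit Defensive.

(* Finite sets and sequences take precedence over classical sets and filters. *)
Import mathcomp.boot.seq mathcomp.boot.fintype mathcomp.boot.finset.
Import GRing.Theory Num.Theory Order.TTheory numFieldNormedType.Exports.

Local Open Scope ring_scope.
Local Open Scope complex_scope.

(** * Runs of equal letters in a cyclic word *)

Lemma filter_rot (X : Type) (p : pred X) k (s : seq X) :
  exists k', filter p (rot k s) = rot k' (filter p s).
Proof.
exists (size (filter p (take k s))).
by rewrite -{3}(cat_take_drop k s) !filter_cat rot_size_cat.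
Qed.

Section Runs.

Variables (X L : eqType) (f : X -> L) (x0 : X).
Implicit Types (s g h : seq X) (a : seq (seq X)).

Definition color g := f (head x0 g).
Definition run g := (g != [::]) && all (fun x => f x == color g) g.

Definition alternating a : Prop :=
  all run a /\
  ((1 < size a)%N -> path.cycle (fun g h => color g != color h) a).

(** The rotation accounts for a run that straddles the ends of the word [s]. *)
Definition cyclic_runs s a : Prop :=
  alternating a /\ exists k, flatten a = rot k s.

Lemma run_neq0 g : run g -> g != [::].
Proof. by case/andP. Qed.

Lemma run_color g x : run g -> x \in g -> f x = color g.
Proof. by case/andP=> _ /allP h /h /eqP. Qed.

Lemma linear_runs s : exists a,
  [/\ flatten a = s, all run a & sorted (fun g h => color g != color h) a].
Proof.
elim: s => [|x s [a [fa ra sa]]]; first by exists [::].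
case: a fa ra sa => [|g a] fa ra sa.
  by exists [:: [:: x]]; rewrite -fa /= /run /color /= eqxx.
have [e|ne] := eqVneq (f x) (color g).
  exists ((x :: g) :: a); rewrite -fa /=; split => //.
    case/andP: ra => rg ra'; apply/andP; split=> //.
    rewrite /run /= {1}/color eqxx; apply/allP => y yg.
    by rewrite (run_color rg yg) -e.
  move: sa; case: a {fa ra} => //= h a.
  by rewrite /color /= -/(color g) -e.
exists ([:: x] :: g :: a); rewrite -fa; split => //.
  by move: ra => /= ->; rewrite /run /color /= eqxx.
by move: sa; rewrite /= => ->; rewrite {1}/color /= ne.
Qed.

Lemma undup_runs a : all run a -> uniq (map color a) ->
  undup (map f (flatten a)) = map color a.
Proof.
elim: a => //= g a IH /andP[rg ra] /andP[ng ua].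
rewrite map_cat undup_cat (IH ra ua).
have -> : map f g = nseq (size g) (color g).
  case/andP: rg => _ /allP rg; rewrite -(size_map f).
  by apply/all_pred1P/allP => _ /mapP[x /rg + ->].
have ncol : color g \notin map f (flatten a).
  apply: contra ng => /mapP[x /flattenP[h ha xh] ->].
  by apply/mapP; exists h; rewrite ?(run_color _ xh) //; apply: (allP ra).
have -> : undup (nseq (size g) (color g)) = [:: color g].
  have := run_neq0 rg; case: (g) => //= y g' _; move: (color _) => c.
  by elim: (size g') => //= k ->; rewrite mem_head.
by rewrite /= ncol.
Qed.

(** The first and the last linear run are glued if they have the same color.
    As [undup] keeps the last occurrence of a color, it passes over the head of
    the word and lists the colors in the order of the glued runs. *)
Lemma cyclic_runsP s : exists2 a, cyclic_runs s a &
  uniq (map color a) -> undup (map f s) = map color a.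
Proof.
have [a [fa ra sa]] := linear_runs s.
case: a fa ra sa => [|h a] fa ra sa.
  by exists [::]; rewrite -fa //; split; [split|exists 0%N].
case/lastP: a fa ra sa => [|l z] fa ra sa.
  exists [:: h]; last by move=> u; rewrite -fa undup_runs.
  by split; [split|exists 0%N; rewrite rot0].
have [e|ne] := eqVneq (color z) (color h); last first.
  exists (h :: rcons l z); last by move=> u; rewrite -fa undup_runs.
  split; last by exists 0%N; rewrite rot0.
  by split=> // _ /=; rewrite rcons_path; move: sa => /= ->; rewrite last_rcons.
have zN : z != [::].
  by apply/run_neq0/(allP ra); rewrite inE mem_rcons inE eqxx orbT.
have ezh : color (z ++ h) = color z by case: (z) zN.
have rz : run z by apply: (allP ra); rewrite inE mem_rcons inE eqxx orbT.
have rh : run h by apply: (allP ra); rewrite inE eqxx.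
have rl : all run l.
  by move: ra; rewrite /= all_rcons => /and3P[].
have rn : all run (rcons l (z ++ h)).
  rewrite all_rcons rl andbT /run ezh; apply/andP; split; first by case: (z) zN.
  apply/allP => x; rewrite mem_cat => /orP[xz|xh].
    by rewrite (run_color rz xz).
  by rewrite (run_color rh xh) e.
exists (rcons l (z ++ h)).
  split; last first.
    exists (size h); rewrite -fa /= rot_size_cat.
    by rewrite !flatten_rcons catA.
  split=> //; case: l sa {fa ra rl rn} => //= g l /andP[hg].
  by rewrite !rcons_path !last_rcons ezh e => /andP[-> ->].
move=> u; rewrite map_rcons ezh -map_rcons.
have u' : uniq (map color (rcons l z)) by move: u; rewrite !map_rcons ezh.
have rz' : all run (rcons l z) by rewrite all_rcons rz.
rewrite -(undup_runs rz' u') -fa /= map_cat undup_cat.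
rewrite (_ : [seq x <- _ | _] = [::]) //.
apply/eqP; rewrite -(negbK (_ == _)) -has_filter -all_predC; apply/allP => c /=.
rewrite mem_undup negbK => /mapP[x xh ->]; rewrite (run_color rh xh) -e.
case: (z) zN rz => // y z' _ ryz; rewrite -(run_color ryz (mem_head _ _)).
by apply: map_f; rewrite flatten_rcons mem_cat mem_head orbT.
Qed.

(** Going once around the circle the color [l] is entered only once when its
    points form an arc, and it is entered at the head of each of its runs. *)
Lemma arc_one_run s a l r u v : uniq s -> cyclic_runs s a ->
  rot r s = u ++ v -> {in u, forall x, f x = l} -> {in v, forall x, f x != l} ->
  (count_mem l (map color a) <= 1)%N.
Proof.
move=> us [[ra ca] [k fk]] rs ul vl.
have [a1|a1] := leqP (size a) 1.
  by apply: leq_trans (count_size _ _) _; rewrite size_map.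
(* Only the heads of the runs are kept: adjacent ones have distinct colors. *)
pose h := map (head x0) a.
have uf : uniq (flatten a) by rewrite fk rot_uniq.
have hE : h = filter (mem h) (flatten a).
  apply/subseq_uniqP => //; rewrite {}/h.
  elim: (a) ra => //= g b IH /andP[rg /IH sb].
  case: g rg => [/run_neq0 //|x g _] /=; rewrite eqxx.
  exact: subseq_trans sb (suffix_subseq _ _).
have [k' hk'] := filter_rot (mem h) k s.
have [r' hr'] := filter_rot (mem h) r s.
have -> : map color a = map f h by rewrite -map_comp.
move: hr'; rewrite rs filter_cat => hr'.
have ch : path.cycle (fun x y => f x != f y)
    (filter (mem h) u ++ filter (mem h) v).
  rewrite hr' rot_cycle -(rot_cycle k') -hk' -fk -hE.
  by have := ca a1; rewrite /h cycle_map.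
rewrite count_map (@seq.permP _ h (filter (mem h) u ++ filter (mem h) v) _);
  last by rewrite [X in perm_eq X]hE fk hk' hr' perm_rot perm_sym perm_rot.
rewrite count_cat [X in (_ + X)%N](_ : _ = 0%N) ?addn0; last first.
  apply/eqP; rewrite -leqn0 leqNgt -has_count; apply/hasPn => x /=.
  by rewrite mem_filter => /andP[_ /vl].
apply: leq_trans (count_size _ _) _.
have : {in filter (mem h) u, forall x, f x = l}.
  by move=> x; rewrite mem_filter => /andP[_ /ul].
case: (filter _ u) ch => [|x [|y w]] //= /andP[/eqP nxy _] uw; case: nxy.
by rewrite !uw ?inE ?eqxx ?orbT.
Qed.

End Runs.

(** * Second order freeness for products of centred runs *)

Lemma cycle_nth (T : Type) (e : rel T) (x0 : T) (s : seq T) (k : 'I_(size s)) :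
  path.cycle e s -> e (nth x0 s k) (nth x0 s (ordS k)).
Proof.
case: s k => [[]//|x s] k /= /pathP - /(_ x0 k).
rewrite size_rcons ltn_ord => /(_ isT).
rewrite -rcons_cons nth_rcons /= ltn_ord.
have [ks|ks] := ltnP k (size s).
  by rewrite nth_rcons ks modn_small.
have -> : val k = size s by apply/eqP; rewrite eqn_leq ks -ltnS ltn_ord.
by rewrite modnn nth_rcons ltnn eqxx.
Qed.

Lemma enum_subset (X : finType) (D D' : {set X}) :
  D' \subset D -> enum D' = filter (mem D') (enum D).
Proof.
move=> /subsetP sD; rewrite /enum_mem -filter_predI.
by apply: eq_filter => x /=; case: (boolP (x \in D')) => // /sD ->.
Qed.

Lemma uniq_flatten_nth (X : eqType) (a : seq (seq X)) k l x : uniq (flatten a) ->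
  x \in nth [::] a k -> x \in nth [::] a l -> k = l.
Proof.
elim: a k l => [|g a IH] [|k] [|l] //=; rewrite cat_uniq => /and3P[_ /hasPn ga ua].
- move=> xg xl; have xa : x \in flatten a.
    apply/flattenP; exists (nth [::] a l) => //; rewrite mem_nth // ltnNge.
    by apply/negP => al; rewrite nth_default in xl.
  by case/negP: (ga _ xa).
- move=> xl xg; have xa : x \in flatten a.
    apply/flattenP; exists (nth [::] a k) => //; rewrite mem_nth // ltnNge.
    by apply/negP => al; rewrite nth_default in xl.
  by case/negP: (ga _ xa).
by move=> xk xl; congr _.+1; apply: IH.
Qed.

Section Algebra.

Variables (R : rcfType) (A : second_order_space R) (r : nat).
Variable B : 'I_r -> {pred A}.
Hypothesis B_subalg : forall k, GRing.subalg_closed (B k).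
Hypothesis B_free : free_second_order B.
Variables (X L : eqType) (lam : X -> L) (i : X -> 'I_r) (e : X -> A) (x0 : X).
Hypothesis i_lam : forall x y, (i x == i y) = (lam x == lam y).
Hypothesis e_in : forall x, e x \in B (i x).

Definition word (s : seq X) : A := \prod_(x <- s) e x.

Lemma word_cat s s' : word (s ++ s') = word s * word s'.
Proof. exact: big_cat. Qed.

Lemma phi_word_rot k s : phi (word (rot k s)) = phi (word s).
Proof.
by rewrite -{2}(cat_take_drop k s) /rot !word_cat phi_tracial.
Qed.

Lemma rho_word_rotl k s y : rho (word (rot k s)) y = rho (word s) y.
Proof.
by rewrite -{2}(cat_take_drop k s) /rot !word_cat rho_traciall.
Qed.

Lemma rho_word_rotr k s x : rho x (word (rot k s)) = rho x (word s).
Proof.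
by rewrite -{2}(cat_take_drop k s) /rot !word_cat rho_tracialr.
Qed.

Notation color := (color lam x0).
Notation run := (run lam x0).
Notation alternating := (alternating lam x0).

Lemma word_run g : run g -> word g \in B (i (head x0 g)).
Proof.
case/andP=> _ /allP h.
have {}h x : x \in g -> i x = i (head x0 g).
  by move=> /h; rewrite -i_lam => /eqP.
move: (i _) h => j h; have [B1 _ BM] := B_subalg j.
elim: g h => [|x g IH] h; first by rewrite /word big_nil.
rewrite /word big_cons BM //; first by rewrite -(h x) ?mem_head ?e_in.
by apply: IH => y yg; apply: h; rewrite inE yg orbT.
Qed.

Definition cen (a : A) : A := (- phi a) *: 1 + a.

Lemma phi_cen a : phi (cen a) = 0.
Proof. by rewrite linearP phi_unit /= mulr1 addNr. Qed.

Lemma cen_in j a : a \in B j -> cen a \in B j.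
Proof. by have [B1 BL _] := B_subalg j => Ba; apply: BL. Qed.

Lemma phi_cenM a b : phi (cen a * cen b) = phi (a * b) - phi a * phi b.
Proof.
rewrite {2}/cen mulrDr linearD /= -scalerAr mulr1 linearZ /= phi_cen mulr0 add0r.
by rewrite /cen mulrDl -scalerAl mul1r linearP /= mulNr addrC.
Qed.

Lemma phi_cen_neq j k a b : a \in B j -> b \in B k -> j != k ->
  phi (cen a * cen b) = 0.
Proof.
move=> Ba Bb jk; have [B1 _ _ _] := B_free.
pose ab (l : 'I_2) := if l == ord0 then cen a else cen b.
have := B1 2%N ab (fun l => if l == ord0 then j else k) isT.
rewrite !big_ord_recl big_ord0 mulr1 /ab /=; apply.
- by move=> l /=; case: ifP => _; apply: cen_in.
- by move=> l /=; case: ifP => _; apply: phi_cen.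
- by move=> [[|[]]//= ?] [[|[]]//= ?].
Qed.

Definition centered_prod (a : seq (seq X)) : A := \prod_(g <- a) cen (word g).

Lemma centered_prodE a : centered_prod a = \prod_(k < size a) cen (word (nth [::] a k)).
Proof. by rewrite /centered_prod (big_nth [::]) big_mkord. Qed.

Lemma centered_prod_cen a :
  centered (fun k : 'I_(size a) => cen (word (nth [::] a k))).
Proof. by move=> k; apply: phi_cen. Qed.

Lemma nth_run a (k : 'I_(size a)) : all run a -> run (nth [::] a k).
Proof. by move=> /allP; apply; apply: mem_nth. Qed.

Lemma color_i g h : (i (head x0 g) == i (head x0 h)) = (color g == color h).
Proof. exact: i_lam. Qed.

Lemma centered_prod_alternating a : (0 < size a)%N -> alternating a ->
  cyclically_alternating B (fun k : 'I_(size a) => cen (word (nth [::] a k))).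
Proof.
move=> a0 [ra ca]; split=> //.
exists (fun k => i (head x0 (nth [::] a k))); split.
  by move=> k; apply/cen_in/word_run/nth_run.
by move=> a1 k; rewrite color_i; have := cycle_nth [::] k (ca a1).
Qed.

Lemma rho_centered_prod_neq a b : (0 < size a)%N -> alternating a ->
  (0 < size b)%N -> alternating b -> size a <> size b ->
  rho (centered_prod a) (centered_prod b) = 0.
Proof.
move=> a0 ca b0 cb ab; have [_ B2 _ _] := B_free.
rewrite !centered_prodE; apply: B2 => //.
- exact: centered_prod_cen.
- exact: centered_prod_alternating.
- exact: centered_prod_cen.
- exact: centered_prod_alternating.
Qed.

Lemma rho_centered_prod_eq p a b : alternating a -> alternating b ->
  size a = p -> size b = p -> (1 < p)%N ->
  rho (centered_prod a) (centered_prod b) = \sum_(k < p) \prod_(j < p)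
    phi (cen (word (nth [::] a j)) *
         cen (word (nth [::] b (iter k (@ordS p) (rev_ord j))))).
Proof.
move=> ca cb ap bp p1; have [_ _ _ B4] := B_free.
have a0 : (0 < size a)%N by rewrite ap ltnW.
have b0 : (0 < size b)%N by rewrite bp ltnW.
have := centered_prod_alternating a0 ca; have := centered_prod_alternating b0 cb.
have := @centered_prod_cen a; have := @centered_prod_cen b.
rewrite !centered_prodE ap bp => c1 c2 c3 c4.
exact: (B4 p _ _ c2 c4 c1 c3 p1).
Qed.

(** A run whose color does not occur on the other circle meets runs of other
    colors only, so that each product over the matched pairs has a factor 0. *)
Lemma rho_centered_prod_lonely a b :
  (0 < size a)%N -> alternating a -> (0 < size b)%N -> alternating b ->
  (exists2 g, g \in a & {in b, forall h, color g != color h}) \/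
  (exists2 h, h \in b & {in a, forall g, color g != color h}) ->
  rho (centered_prod a) (centered_prod b) = 0.
Proof.
move=> a0 ca b0 cb lon; case: (ca) (cb) => ra _ [rb _].
have [ab|ab] := eqVneq (size a) (size b); last first.
  by apply: rho_centered_prod_neq => //; apply/eqP.
have zero g h : g \in a -> h \in b -> color g != color h ->
    phi (cen (word g) * cen (word h)) = 0.
  move=> ga hb; rewrite -color_i; apply: phi_cen_neq; apply: word_run.
    exact: (allP ra).
  exact: (allP rb).
have [a1|a1] := leqP (size a) 1.
  have [_ _ B3 _] := B_free.
  case: a a0 ab ca ra lon zero a1 => // g [] // _; case: b b0 cb rb => // h [] // _.
  move=> cb /= /andP[rh _] _ ca /andP[rg _] lon _ _.
  have gh : color g != color h.
    by case: lon => [[k]|[k]]; rewrite inE => /eqP -> -> //; rewrite inE.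
  rewrite /centered_prod !big_seq1.
  apply: (B3 (i (head x0 g)) (i (head x0 h)) _ _
    (cen_in (word_run rg)) (cen_in (word_run rh))).
  by rewrite color_i.
rewrite (rho_centered_prod_eq (p := size a)) // big1 // => k _.
pose s (j : 'I_(size a)) := iter k (@ordS (size a)) (rev_ord j).
have sb j : nth [::] b (s j) \in b by apply: mem_nth; rewrite -ab.
case: lon => [[g ga gb]|[h hb ha]].
  have gi : (index g a < size a)%N by rewrite index_mem.
  rewrite (bigD1 (Ordinal gi)) //= nth_index // zero ?mul0r //; first exact: sb.
  exact/gb/sb.
have hi : (index h b < size a)%N by rewrite ab index_mem.
have sI : injective s.
  move=> x y; rewrite /s; elim: (val k) => /= [|c IH]; first exact: rev_ord_inj.
  by move/(@ordS_inj _)/IH.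
rewrite (bigD1 (invF sI (Ordinal hi))) //=.
have -> : iter k (@ordS (size a)) (rev_ord (invF sI (Ordinal hi))) = Ordinal hi.
  exact: (f_invF sI).
rewrite nth_index // zero ?mul0r // ?mem_nth //.
by apply: ha; rewrite mem_nth.
Qed.

(** In the expansion of the product, [J] is the set of the runs that are
    replaced by their expectations; the other runs concatenate to a subword. *)
Lemma centered_prod_expand a : uniq (flatten a) -> centered_prod a =
  \sum_(J : {set 'I_(size a)}) (\prod_(k in J) - phi (word (nth [::] a k))) *:
     word [seq x <- flatten a | ~~ [exists k in J, x \in nth [::] a k]].
Proof.
move=> ua; rewrite centered_prodE /cen bigA_distr.
apply: eq_big => // J _.
transitivity (\prod_(k < size a) ((if k \in J then - phi (word (nth [::] a k)) else 1)
   *: (if k \in J then 1 else word (nth [::] a k)))).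
  by apply: eq_bigr => k _; case: ifP => // _; rewrite scale1r.
rewrite scaler_prod -big_mkcond /=; congr (_ *: _).
rewrite /word big_filter big_flatten (big_nth [::]) big_mkord.
apply: eq_bigr => k _; case: ifP => kJ.
  rewrite big_seq_cond big_pred0 // => x; apply/negbTE/negP => /andP[xk /negP[]].
  by apply/existsP; exists k; rewrite kJ.
rewrite [RHS]big_seq_cond [LHS]big_seq_cond; apply: eq_bigl => x.
case xk : (x \in nth [::] a k) => //=; symmetry.
apply/negP => /existsP[l /andP[lJ xl]].
by move: kJ; rewrite (val_inj (uniq_flatten_nth ua xk xl)) lJ.
Qed.


End Algebra.

(** * Runs along two circles *)

Lemma count_le1_nth (X : Type) (p : pred X) x0 (s : seq X) k l :
  (count p s <= 1)%N -> (k < size s)%N -> (l < size s)%N ->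
  p (nth x0 s k) -> p (nth x0 s l) -> k = l.
Proof.
elim: s k l => [|y s IH] [|k] [|l] //= ps ks ls pk pl.
- move: ps; rewrite pk -[X in (_ <= X)%N]addn0 leq_add2l leqn0 => /eqP.
  by move/eqP; rewrite -leqn0 leqNgt -has_count => /(has_nthP x0)[]; exists l.
- move: ps; rewrite pl -[X in (_ <= X)%N]addn0 leq_add2l leqn0 => /eqP.
  by move/eqP; rewrite -leqn0 leqNgt -has_count => /(has_nthP x0)[]; exists k.
by congr _.+1; apply: IH => //; apply: leq_trans ps; rewrite leq_addl.
Qed.

(** The sets that contain [z0] are paired with those that do not, and all pairs
    but one cancel. *)
Lemma toggle_sum (V : zmodType) (I : finType) (z0 : I) (f : {set I} -> V) :
  \sum_(Z : {set I}) f Z = 0 ->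
  (forall Z : {set I}, z0 \notin Z -> Z != set0 -> f (z0 |: Z) = - f Z) ->
  f [set z0] = - f set0.
Proof.
move=> f0 fz; apply/eqP; rewrite -addr_eq0; apply/eqP.
rewrite -[RHS]f0 (bigID (fun Z : {set I} => z0 \in Z)) /=.
rewrite (reindex_onto (fun Z : {set I} => z0 |: Z) (fun Z => Z :\ z0)) /=; last first.
  by move=> Z zZ; rewrite setD1K.
rewrite (eq_bigl (fun Z : {set I} => z0 \notin Z)); last first.
  move=> Z; rewrite setU11 /=; apply/eqP/idP => [<-|zZ].
    by rewrite !inE eqxx.
  by rewrite setU1K.
rewrite -big_split /= (bigD1 set0) ?inE //= setU0 big1 ?addr0 // => Z /andP[zZ Z0].
by rewrite fz // addNr.
Qed.

Lemma subseq_flatten_nth (X : eqType) (s : seq (seq X)) k :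
  (k < size s)%N -> subseq (nth [::] s k) (flatten s).
Proof.
elim: s k => // g s IH [|k] /= ks; first exact: prefix_subseq.
by apply: subseq_trans (IH _ ks) _; apply: suffix_subseq.
Qed.

Section Circles.

Variables n m : nat.
Notation X := 'I_(n + m).
Notation c1 := (circle1 n m).
Notation c2 := (circle2 n m).
Implicit Types (D U : {set X}).

(** The condition under which a block [U] of a partial partition of the points
    [D] can be removed. *)
Definition circle_arc D U : bool :=
  ((U \subset c1) && consecutive (D :&: c1) U) ||
  ((U \subset c2) && consecutive (D :&: c2) U).

Lemma consecutiveP D U :
  reflect (exists r u v, rot r (enum D) = u ++ v /\ U =i u) (consecutive D U).
Proof.
apply: (iffP existsP) => [[r /eqP eU]|[r [u [v [eD eU]]]]].
  exists r, (take #|U| (rot r (enum D))), (drop #|U| (rot r (enum D))).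
  by rewrite cat_take_drop; split=> // x; rewrite {1}eU !inE.
have uu : uniq u.
  by have := enum_uniq (mem D); rewrite -(rot_uniq r) eD cat_uniq => /and3P[].
have sU : #|U| = size u.
  by rewrite (eq_card eU); apply/card_uniqP.
have [rD|rD] := leqP r #|D|.
  exists (Ordinal (n:=#|D|.+1) (m:=r) rD) => /=; apply/eqP/setP => x.
  by rewrite eD sU take_size_cat // inE eU.
exists ord0; apply/eqP/setP => x; rewrite rot0.
rewrite rot_oversize -?cardE 1?ltnW // in eD.
by rewrite eD sU take_size_cat // inE eU.
Qed.

(** Deletion of points turns a rotation of the enumeration into a rotation of
    the new one, and it leaves the initial segment [U] untouched. *)
Lemma arc_subset D D' U : D' \subset D -> U \subset D' ->
  circle_arc D U -> circle_arc D' U.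
Proof.
move=> sD sU; have cons c : consecutive (D :&: c) U -> consecutive (D' :&: c) U.
  case/consecutiveP => r [u [v [eD eU]]]; apply/consecutiveP.
  have sDc : D' :&: c \subset D :&: c by apply: setSI.
  have [r' er] := filter_rot (mem (D' :&: c)) r (enum (D :&: c)).
  exists r', u, (filter (mem (D' :&: c)) v); rewrite (enum_subset sDc) -er eD.
  rewrite filter_cat; split=> //; congr (_ ++ _); apply/all_filterP/allP => x xu.
  have : x \in D :&: c by rewrite -mem_enum -(mem_rot r) eD mem_cat xu.
  by rewrite -eU in xu; rewrite !inE (subsetP sU) // => /andP[_ ->].
by case/orP=> /andP[Uc /cons cU]; rewrite /circle_arc Uc cU ?orbT.
Qed.

Variables (L : eqType) (lam : X -> L) (x0 : X).
Notation color := (color lam x0).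
Notation run := (run lam x0).
Notation cyclic_runs := (cyclic_runs lam x0).

Lemma consecutive_one_run (E U : {set X}) a l k k' :
  cyclic_runs (enum E) a -> consecutive E U ->
  {in E, forall x, (lam x == l) = (x \in U)} -> (k < size a)%N -> (k' < size a)%N ->
  color (nth [::] a k) = l -> color (nth [::] a k') = l -> k = k'.
Proof.
move=> ra /consecutiveP[r [u [v [eE eU]]]] lU ka ka' ck ck'.
have sE x : x \in u ++ v -> x \in E by rewrite -eE mem_rot mem_enum.
have ct : (count_mem l (map color a) <= 1)%N.
  apply: (arc_one_run (enum_uniq _) ra eE) => x xu.
    by apply/eqP; rewrite lU ?eU // sE // mem_cat xu.
  rewrite lU ?eU ?sE ?mem_cat ?xu ?orbT //.
  have := enum_uniq (mem E); rewrite -(rot_uniq r) eE cat_uniq.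
  by case/and3P=> _ /hasPn /(_ x xu).
by apply: (count_le1_nth (x0:=l) ct); rewrite ?size_map // (nth_map [::]) //=; apply/eqP.
Qed.

Section RunsOfBothCircles.
Variables (a b : seq (seq X)).

Definition run_at (z : 'I_(size a) + 'I_(size b)) : seq X :=
  match z with inl k => nth [::] a k | inr k => nth [::] b k end.

Definition points (Z : {set 'I_(size a) + 'I_(size b)}) : {set X} :=
  [set x | [exists z in Z, x \in run_at z]].

Lemma pointsP (Z : {set 'I_(size a) + 'I_(size b)}) x :
  reflect (exists2 z, z \in Z & x \in run_at z) (x \in points Z).
Proof. by rewrite inE; apply: exists_inP. Qed.

Variable D : {set X}.
Hypothesis runs1 : cyclic_runs (enum (D :&: c1)) a.
Hypothesis runs2 : cyclic_runs (enum (D :&: c2)) b.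

Lemma mem_runs1 x : (x \in flatten a) = (x \in D :&: c1).
Proof. by case: runs1 => _ [k ->]; rewrite mem_rot mem_enum. Qed.

Lemma mem_runs2 x : (x \in flatten b) = (x \in D :&: c2).
Proof. by case: runs2 => _ [k ->]; rewrite mem_rot mem_enum. Qed.

Lemma uniq_runs1 : uniq (flatten a).
Proof. by case: runs1 => _ [k ->]; rewrite rot_uniq enum_uniq. Qed.

Lemma uniq_runs2 : uniq (flatten b).
Proof. by case: runs2 => _ [k ->]; rewrite rot_uniq enum_uniq. Qed.

Lemma run_at_run z : run (run_at z).
Proof.
by case: z => k; apply: (allP _ _ (mem_nth _ _)); rewrite ?ltn_ord //;
  [case: runs1 => [[]]|case: runs2 => [[]]].
Qed.

Lemma mem_run_at1 k x : x \in run_at (inl k) -> x \in D :&: c1.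
Proof.
by move=> xk; rewrite -mem_runs1; apply/flattenP; exists (nth [::] a k); rewrite ?mem_nth.
Qed.

Lemma mem_run_at2 k x : x \in run_at (inr k) -> x \in D :&: c2.
Proof.
by move=> xk; rewrite -mem_runs2; apply/flattenP; exists (nth [::] b k); rewrite ?mem_nth.
Qed.

Lemma circle2E x : (x \in c2) = (x \notin c1).
Proof. by rewrite !inE leqNgt. Qed.

Lemma run_at_inj z z' x : x \in run_at z -> x \in run_at z' -> z = z'.
Proof.
case: z => k; case: z' => l xk xl.
- by congr inl; apply/val_inj/(uniq_flatten_nth uniq_runs1 xk xl).
- have := mem_run_at1 xk; have := mem_run_at2 xl; rewrite !in_setI circle2E.
  by case/andP=> _ /negPf->; rewrite andbF.
- have := mem_run_at1 xl; have := mem_run_at2 xk; rewrite !in_setI circle2E.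
  by case/andP=> _ /negPf->; rewrite andbF.
- by congr inr; apply/val_inj/(uniq_flatten_nth uniq_runs2 xk xl).
Qed.

Lemma run_at_sub z x : x \in run_at z -> x \in D.
Proof. by case: z => k => [/mem_run_at1|/mem_run_at2]; rewrite inE => /andP[]. Qed.

Lemma run_at_cover x : x \in D -> exists z, x \in run_at z.
Proof.
move=> xD; have [x1|x1] := boolP (x \in c1).
  have : x \in flatten a by rewrite mem_runs1 inE xD.
  case/flattenP => g /(nthP [::])[k ka <-] xg.
  by exists (inl (Ordinal ka)).
have : x \in flatten b by rewrite mem_runs2 inE xD circle2E.
case/flattenP => g /(nthP [::])[k ka <-] xg.
by exists (inr (Ordinal ka)).
Qed.

Lemma head_run_at z : head x0 (run_at z) \in run_at z.
Proof.
have := run_neq0 (run_at_run z); case: (run_at z) => //= x s _.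
exact: mem_head.
Qed.

Lemma run_at_color z x : x \in run_at z -> lam x = color (run_at z).
Proof. exact/run_color/run_at_run. Qed.

Lemma run_at_rot U z : U =i run_at z -> exists k, run_at z = rot k (enum U).
Proof.
have aux c s k l : flatten s = rot l (enum (D :&: c)) -> (k < size s)%N ->
    U =i nth [::] s k -> {subset nth [::] s k <= D :&: c} ->
    exists k', nth [::] s k = rot k' (enum U).
  move=> fs ks eU sU.
  have [k' ek'] := filter_rot (mem U) l (enum (D :&: c)); exists k'.
  rewrite (enum_subset (D := D :&: c)) -?ek'; last first.
    by apply/subsetP => x; rewrite eU => /sU.
  rewrite -fs (eq_filter (a2 := mem (nth [::] s k))) //.
  by apply/subseq_uniqP; rewrite ?subseq_flatten_nth // fs rot_uniq enum_uniq.
case: z => k eU.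
  by have [_ [l fl]] := runs1; apply: (aux _ _ _ _ fl) => // x /mem_run_at1.
by have [_ [l fl]] := runs2; apply: (aux _ _ _ _ fl) => // x /mem_run_at2.
Qed.

Lemma size_runs1 : D :&: c1 != set0 -> (0 < size a)%N.
Proof.
by case/set0Pn=> x; rewrite -mem_runs1; case: (a).
Qed.

Lemma size_runs2 : D :&: c2 != set0 -> (0 < size b)%N.
Proof.
by case/set0Pn=> x; rewrite -mem_runs2; case: (b).
Qed.

Lemma arc_one_group U l z z' : circle_arc D U ->
  {in D, forall x, (lam x == l) = (x \in U)} ->
  color (run_at z) = l -> color (run_at z') = l -> z = z'.
Proof.
move=> aU lU.
have colU y : color (run_at y) = l -> head x0 (run_at y) \in U.
  by move=> cy; rewrite -lU ?(run_at_sub (head_run_at y)) //; apply/eqP.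
have lUc c : {in D :&: c, forall x, (lam x == l) = (x \in U)}.
  by move=> x /setIP[xD _]; apply: lU.
case/orP: aU => /andP[/subsetP Uc cU] cz cz'.
- have nin k : color (run_at (inr k)) <> l.
    move=> /colU /Uc; have := mem_run_at2 (head_run_at (inr k)).
    by rewrite in_setI circle2E => /andP[_ /negPf->].
  case: z cz => k ck; last by case: (nin k ck).
  case: z' cz' => k' ck'; last by case: (nin k' ck').
  by congr inl; apply: val_inj; apply: (consecutive_one_run runs1 cU (lUc _) _ _ ck ck').
- have nin k : color (run_at (inl k)) <> l.
    move=> /colU /Uc; have := mem_run_at1 (head_run_at (inl k)).
    by rewrite in_setI circle2E => /andP[_ ->].
  case: z cz => k ck; first by case: (nin k ck).
  case: z' cz' => k' ck'; first by case: (nin k' ck').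
  by congr inr; apply: val_inj; apply: (consecutive_one_run runs2 cU (lUc _) _ _ ck ck').
Qed.

End RunsOfBothCircles.
End Circles.

(** * Factoring out a class that is an arc *)

Section Correlations.

Variables (R : rcfType) (A : second_order_space R) (r : nat).
Variable B : 'I_r -> {pred A}.
Hypothesis B_subalg : forall k, GRing.subalg_closed (B k).
Hypothesis B_free : free_second_order B.
Variables n m : nat.
Notation X := 'I_(n + m).
Notation c1 := (circle1 n m).
Notation c2 := (circle2 n m).
Variables (L : eqType) (lam : X -> L) (i : X -> 'I_r) (e : X -> A) (x0 : X).
Hypothesis i_lam : forall x y, (i x == i y) = (lam x == lam y).
Hypothesis e_in : forall x, e x \in B (i x).
Implicit Types (D U : {set X}).

Notation color := (color lam x0).
Notation cyclic_runs := (cyclic_runs lam x0).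

Definition corr D : R[i]%C :=
  rho (word e (enum (D :&: c1))) (word e (enum (D :&: c2))).

Lemma corr_empty D : D :&: c1 = set0 \/ D :&: c2 = set0 -> corr D = 0.
Proof.
rewrite /corr => -[->|->]; rewrite enum_set0 /word big_nil ?rho_unitl //.
exact: rho_unitr.
Qed.

Lemma corr_filter D D' a b :
  cyclic_runs (enum (D :&: c1)) a -> cyclic_runs (enum (D :&: c2)) b ->
  D' \subset D ->
  corr D' = rho (word e (filter (mem D') (flatten a)))
                (word e (filter (mem D') (flatten b))).
Proof.
move=> [_ [k ->]] [_ [l ->]] sD.
have E c : filter (mem D') (enum (D :&: c)) = enum (D' :&: c).
  rewrite (enum_subset (setSI c sD)); apply: eq_in_filter => x.
  by rewrite mem_enum /= !inE => /andP[_ ->]; rewrite andbT.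
have [k' ->] := filter_rot (mem D') k (enum (D :&: c1)).
have [l' ->] := filter_rot (mem D') l (enum (D :&: c2)).
by rewrite !E rho_word_rotl rho_word_rotr.
Qed.

(** Here [Z] is the set of the runs, of either circle, that are replaced by
    their expectations. *)
Lemma corr_expand D a b :
  cyclic_runs (enum (D :&: c1)) a -> cyclic_runs (enum (D :&: c2)) b ->
  rho (centered_prod e a) (centered_prod e b) =
  \sum_(Z : {set 'I_(size a) + 'I_(size b)})
    (\prod_(z in Z) - phi (word e (run_at z))) * corr (D :\: points Z).
Proof.
move=> ra rb; rewrite !centered_prod_expand; last 2 first.
- exact: uniq_runs2 rb.
- exact: uniq_runs1 ra.
rewrite linear_sumlz; under eq_bigr do rewrite linear_sumr.
rewrite pair_big /=.
pose h (p : {set 'I_(size a)} * {set 'I_(size b)}) :=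
  [set z : 'I_(size a) + 'I_(size b) |
     match z with inl k => k \in p.1 | inr k => k \in p.2 end].
pose h' (Z : {set 'I_(size a) + 'I_(size b)}) :=
  ([set k | inl k \in Z], [set k | inr k \in Z]).
rewrite [RHS](reindex_onto h h') /=; last first.
  by move=> Z _; apply/setP => -[k|k]; rewrite !inE.
apply: eq_big => [[J K]|[J K] _].
  by apply/esym/eqP; congr (_, _); apply/setP => k; rewrite !inE.
rewrite linearZl_LR linearZr_LR /= mulrA; congr (_ * _).
  rewrite big_mkcond [in RHS]big_mkcond big_sumType /=; congr (_ * _).
    by rewrite [in LHS]big_mkcond; apply: eq_bigr => k _; rewrite !inE.
  by rewrite big_mkcond; apply: eq_bigr => k _; rewrite !inE.
rewrite (corr_filter ra rb) ?subsetDl //.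
congr (rho (word e _) (word e _)); apply: eq_in_filter => x xa /=.
  have /setIP[xD x1] : x \in D :&: c1 by rewrite -(mem_runs1 ra).
  rewrite in_setD xD andbT; congr (~~ _); apply/exists_inP/pointsP => -[].
    by move=> k kJ xk; exists (inl k); rewrite ?inE.
  case=> k; rewrite inE /= => kJ xk; first by exists k.
  by have := mem_run_at2 (a := a) rb xk; rewrite in_setI circle2E x1 /= andbF.
have /setIP[xD x1] : x \in D :&: c2 by rewrite -(mem_runs2 rb).
rewrite in_setD xD andbT; congr (~~ _); apply/exists_inP/pointsP => -[].
  by move=> k kJ xk; exists (inr k); rewrite ?inE.
case=> k; rewrite inE /= => kJ xk; last by exists k.
move: x1; rewrite circle2E => /negPf x1.
by have := mem_run_at1 (b := b) ra xk; rewrite in_setI x1 andbF.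
Qed.

(** The centred product vanishes, as the run of the class [U] has no partner.
    In its expansion the terms that keep this run cancel, by induction, against
    those that replace it by its expectation; only the term without any
    replacement and the one that replaces nothing but [U] are left. *)
Lemma corr_arc D U l : U \subset D -> U != set0 -> circle_arc D U ->
  {in D, forall x, (lam x == l) = (x \in U)} ->
  corr D = phi (word e (enum U)) * corr (D :\: U).
Proof.
have [N] := ubnP #|D|; elim: N D => // N IH D DN sU U0 aU lU.
have [D1|D1] := eqVneq (D :&: c1) set0.
  rewrite !corr_empty ?mulr0 //; left => //.
  by apply/eqP; rewrite -subset0 -D1 setSI ?subsetDl.
have [D2|D2] := eqVneq (D :&: c2) set0.
  rewrite !corr_empty ?mulr0 //; right => //.
  by apply/eqP; rewrite -subset0 -D2 setSI ?subsetDl.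
have [a ra _] := cyclic_runsP lam x0 (enum (D :&: c1)).
have [b rb _] := cyclic_runsP lam x0 (enum (D :&: c2)).
have [x xU] := set0Pn _ U0.
have xD := subsetP sU _ xU.
have [z0 xz0] := run_at_cover ra rb xD.
have cz0 : color (run_at z0) = l.
  by rewrite -(run_at_color ra rb xz0); apply/eqP; rewrite lU.
have gz0 y : (y \in run_at z0) = (y \in U).
  apply/idP/idP => [yz|yU].
    by rewrite -lU ?(run_at_sub ra rb yz) // (run_at_color ra rb yz) cz0.
  have yD := subsetP sU _ yU; have [z yz] := run_at_cover ra rb yD.
  suff -> : z0 = z by [].
  apply: (arc_one_group ra rb aU lU cz0).
  by rewrite -(run_at_color ra rb yz); apply/eqP; rewrite lU.
have phi0 : phi (word e (run_at z0)) = phi (word e (enum U)).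
  have [k ->] : exists k, run_at z0 = rot k (enum U).
    by apply: (run_at_rot ra rb) => y; rewrite gz0.
  exact: phi_word_rot.
have a0 := size_runs1 ra D1; have b0 := size_runs2 rb D2.
(* The class [U] is the single run [z0], without a partner on the other circle. *)
have cp0 : rho (centered_prod e a) (centered_prod e b) = 0.
  apply: (rho_centered_prod_lonely (x0 := x0) B_subalg B_free i_lam e_in) => //.
  - by case: ra.
  - by case: rb.
  case: (z0) cz0 => k ck.
    left; exists (nth [::] a k); first exact: mem_nth.
    move=> g /(nthP [::])[k' kb <-]; rewrite [X in X == _]ck; apply/eqP => /esym ck'.
    by have := arc_one_group (z' := inr (Ordinal kb)) ra rb aU lU ck ck'.
  right; exists (nth [::] b k); first exact: mem_nth.
  move=> g /(nthP [::])[k' ka <-]; rewrite [X in _ == X]ck; apply/eqP => ck'.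
  by have := arc_one_group (z' := inl (Ordinal ka)) ra rb aU lU ck ck'.
have := corr_expand ra rb; rewrite cp0 => /esym /(toggle_sum (z0 := z0)).
rewrite big_set1 big_set0 mul1r.
have p0 : @points n m a b set0 = set0.
  by apply/setP => y; rewrite in_set0; apply/pointsP => -[z]; rewrite inE.
have pU Z : points (z0 |: Z) = U :|: points Z.
  apply/setP => y; rewrite in_setU -gz0; apply/pointsP/orP.
    by case=> z /setU1P[->|zZ] yz; [left|right; apply/pointsP; exists z].
  case=> [yz|/pointsP[z zZ yz]]; first by exists z0; rewrite ?setU11.
  by exists z; rewrite ?setU1r.
rewrite -[X in points X]setU0 pU p0 setU0 setD0 phi0 mulNr => /(_ _)/oppr_inj <- //.
move=> Z z0Z Z0; have sUZ : U \subset D :\: points Z.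
  apply/subsetP => y yU; rewrite in_setD (subsetP sU _ yU) andbT.
  apply/pointsP => -[z zZ yz]; case/negP: z0Z.
  by rewrite (run_at_inj ra rb (z := z0) _ yz) ?gz0.
rewrite big_setU1 //= phi0 pU setUC -setDDl.
rewrite (IH (D :\: points Z)).
- by rewrite !mulNr !mulrA; congr (- (_ * _)); rewrite mulrC.
- have [z zZ] := set0Pn _ Z0.
  rewrite -ltnS; apply: leq_trans DN; rewrite ltnS.
  apply: proper_card; rewrite properEneq subsetDl andbT.
  apply/negP => /eqP eD; have := run_at_sub ra rb (head_run_at ra rb z).
  rewrite -eD in_setD => /andP[/negP[]]; apply/pointsP; exists z => //.
  exact: head_run_at ra rb z.
- by [].
- by [].
- exact: arc_subset (subsetDl _ _) sUZ aU.
by move=> y; rewrite in_setD => /andP[_ yD]; apply: lU.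
Qed.

End Correlations.

(** * Annular partitions *)

Section Annular.

Variables n m : nat.
Notation X := 'I_(n + m).
Notation c1 := (circle1 n m).
Notation c2 := (circle2 n m).
Implicit Types (D U : {set X}) (P Q : {set {set X}}).

(** The recursive test of $NC(n,m)$, for partial partitions. *)
Definition annular P : bool :=
  [exists Q, connect (@remove_block n m) P Q && irreducible_annular Q].

Lemma removableE P U : removable P U = circle_arc (cover P) U.
Proof. by []. Qed.

(** This is why two removals commute. *)
Lemma removable_remove P U U' : U \in P -> U != U' -> removable P U ->
  removable (P :\ U') U.
Proof.
rewrite !removableE => UP UU'; apply: arc_subset.
  by apply/bigcupsP => V /setD1P[_ VP]; apply: bigcup_sup.
by rewrite /cover (bigcup_sup U) // in_setD1 UU'.
Qed.

(** Since an irreducible partition has no removable block, [U] is removed at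
    some stage of any successful reduction, and it can be removed first. *)
Lemma annular_remove P U : U \in P -> removable P U ->
  annular P = annular (P :\ U).
Proof.
move=> UP rU; apply/existsP/existsP => -[Q /andP[PQ irrQ]]; exists Q; last first.
  rewrite irrQ andbT; apply: connect_trans (connect1 _) PQ.
  by apply/exists_inP; exists U; rewrite ?rU ?eqxx.
rewrite irrQ andbT; case/connectP: PQ => p + eQ.
elim: p P UP rU eQ => [|P' p IH] P UP rU /= eQ.
  case/and5P: irrQ => /forall_inP /(_ U) + _ _ _ _.
  by rewrite eQ UP rU => /(_ isT).
case/andP => /exists_inP[U' U'P /andP[rU' /eqP eP']] pp.
have [eU|nU] := eqVneq U U'.
  by apply/connectP; exists p; rewrite eU -eP'.
have UP' : U \in P' by rewrite eP' in_setD1 nU.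
apply: connect_trans (IH _ UP' _ eQ pp); last by rewrite eP' removable_remove.
apply: connect1; apply/exists_inP; exists U'; first by rewrite in_setD1 eq_sym nU.
by rewrite removable_remove // 1?eq_sym //= eP' !setDDl setUC.
Qed.

Lemma annular_cover P : annular P -> cover P :&: c1 != set0 /\ cover P :&: c2 != set0.
Proof.
case/existsP=> Q /andP[/connectP[p +]].
elim: p P => /= [P _ ->|P' p IH P /andP[/exists_inP[U UP /andP[_ /eqP eP']] pp] eQ iQ].
  by case/and5P.
have [h1 h2] := IH _ pp eQ iQ.
have sP : cover P' \subset cover P.
  by rewrite eP'; apply/bigcupsP => V /setD1P[_ VP]; apply: bigcup_sup.
split.
  by apply: contraNneq h1 => h; rewrite -subset0 -h setSI.
by apply: contraNneq h2 => h; rewrite -subset0 -h setSI.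
Qed.

Section Weight.
Variables (K : comNzRingType) (T : Type).
Variables (psi1 : seq T -> K) (psi2 : seq T -> seq T -> K) (t : X -> T).

Lemma psi_partition_remove P U : U \in P -> removable P U ->
  psi_partition psi1 psi2 t P =
  psi1 (map t (enum U)) * psi_partition psi1 psi2 t (P :\ U).
Proof.
move=> UP rU; rewrite /psi_partition (big_setD1 U) //=.
have nU : is_through U = false.
  rewrite /is_through; apply/negbTE; rewrite negb_and !negbK.
  case/orP: rU => /andP[/subsetP sU _]; apply/orP; [right|left].
    apply/eqP/setP => x; rewrite in_setI circle2E in_set0.
    by apply/negP => /andP[/sU ->].
  apply/eqP/setP => x; rewrite in_setI in_set0.
  by apply/negP => /andP[/sU]; rewrite circle2E => /negPf->.
congr (_ * _); first by rewrite /psi_block nU.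
apply: eq_bigr => V /setD1P[VU VP]; rewrite /psi_block /through_cycle.
have -> // : through_blocks (P :\ U) = through_blocks P.
apply/setP => W; rewrite !inE; case: eqP => [->|] //=.
by rewrite nU andbF.
Qed.
End Weight.



(** Only the first point of a proper arc has its predecessor outside. *)
Lemma from_first_arc (E U : {set X}) r g v : rot r (enum E) = g ++ v ->
  g != [::] -> v != [::] -> U =i g -> from_first E U = g.
Proof.
move=> rE g0 v0 eU; rewrite /from_first; set s := enum E in rE *.
have us : uniq s by apply: enum_uniq.
case: g g0 rE eU => // h g _ rE eU.
have uw : uniq (h :: g ++ v) by rewrite -cat_cons -rE rot_uniq.
have find_h : find [pred x in U | prev s x \notin U] s = index h s.
  apply: eq_in_find => x xs /=; rewrite -(prev_rot r) // rE.
  have xw : x \in h :: g ++ v by rewrite -cat_cons -rE mem_rot.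
  rewrite prev_nth cat_cons xw !eU; apply/andP/eqP => [[xg]|->].
    apply: contraNeq => xh; move: xg; rewrite inE (negPf xh) /= => xg.
    rewrite index_cat xg -cat_cons nth_cat /= ltnS ltnW ?index_mem //.
    by rewrite mem_nth //= ltnS ltnW // index_mem.
  split; first exact: mem_head.
  have hgv : h \notin g ++ v by case/andP: uw.
  rewrite memNindex // nth_last /= last_cat.
  have lv : last (last h g) v \in v.
    by case: (v) v0 => //= y w _; apply: mem_last.
  move: uw; rewrite -cat_cons cat_uniq => /and3P[_ /hasPn/(_ _ lv)] //.
have rr : rot (index h s) s = h :: g ++ v.
  have hs : h \in s by rewrite -(mem_rot r) rE mem_head.
  rewrite -cat_cons -rE; have [rr|rr] := leqP (size s) r.
    by rewrite (rot_oversize rr) in rE *; rewrite rE /= eqxx rot0.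
  have hh : nth h s r = h by move: rE; rewrite /rot (drop_nth h rr) => -[].
  by rewrite -{1}hh index_uniq.
rewrite find_h rr -cat_cons filter_cat.
have -> : filter [pred x | x \in U] (h :: g) = h :: g.
  by apply/all_filterP/allP => x /=; rewrite eU.
rewrite -[RHS]cats0; congr (_ ++ _); apply/eqP.
rewrite -(negbK (_ == _)) -has_filter; apply/hasPn => x xv /=; rewrite eU.
by move: uw; rewrite -cat_cons cat_uniq => /and3P[_ /hasPn/(_ _ xv)].
Qed.

End Annular.

(** * Irreducible annular partitions as matchings of runs *)

Lemma iter_ordS p k (x : 'I_p) : iter k (@ordS p) x = ((x + k) %% p)%N :> nat.
Proof.
elim: k => [|k IH] /=; first by rewrite addn0 modn_small.
by rewrite IH -addn1 modnDml addn1 addnS.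
Qed.

(** The index in the spoke sum runs backwards through the second circle, so it
    reads a rotation of the reversed word. *)
Lemma nth_rot_rev (T : Type) (y0 : T) (s : seq T) p (k j : 'I_p) : size s = p ->
  nth y0 (rot (p - k) (rev s)) j = nth y0 s (iter k (@ordS p) (rev_ord j)).
Proof.
move=> sp; have jp := ltn_ord j; have kp := ltn_ord k.
rewrite iter_ordS /= /rot nth_cat size_drop size_rev sp subKn; last exact: ltnW.
case: ltnP => jk.
  rewrite nth_drop nth_rev ?sp; last by lia.
  have -> : (p - j.+1 + k = (k - j.+1) + p)%N by lia.
  by congr nth; rewrite modnDr modn_small; lia.
rewrite nth_take; last by lia.
rewrite nth_rev ?sp; last by lia.
by congr nth; rewrite modn_small; lia.
Qed.

Lemma rot_rev_nth (T : eqType) (y0 : T) (s s' : seq T) p r :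
  size s' = p -> (0 < p)%N -> s = rot r (rev s') ->
  exists k : 'I_p, forall j : 'I_p,
     nth y0 s j = nth y0 s' (iter k (@ordS p) (rev_ord j)).
Proof.
move=> sp' p0 es.
have [r' rp {}es] : exists2 r', (r' < p)%N & s = rot r' (rev s').
  have [rp|rp] := ltnP r p; first by exists r.
  by exists 0%N; rewrite // es rot0 rot_oversize // size_rev sp'.
have kp : ((if r' is 0 then 0 else p - r') < p)%N.
  by case: r' rp {es} => // r' rp; rewrite ltn_subrL.
exists (Ordinal kp) => j; rewrite -nth_rot_rev // es; congr nth => /=.
case: r' rp {es kp} => [|r'] rp; last by rewrite subKn // ltnW.
by rewrite subn0 rot0 rot_oversize ?size_rev ?sp'.
Qed.

Lemma nth_rot_revP (T : eqType) (y0 : T) (s s' : seq T) p (k : 'I_p) :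
  size s = p -> size s' = p ->
  (forall j : 'I_p, nth y0 s j = nth y0 s' (iter k (@ordS p) (rev_ord j))) ->
  s = rot (p - k) (rev s').
Proof.
move=> sp sp' hk; apply: (@eq_from_nth _ y0).
  by rewrite size_rot size_rev sp.
by rewrite sp => j jp; rewrite (hk (Ordinal jp)) -nth_rot_rev.
Qed.

Lemma undup_map_in (T T' : eqType) (f : T -> T') (s : seq T) :
  {in s &, injective f} -> undup (map f s) = map f (undup s).
Proof.
elim: s => //= x s IH fI; have fs : {in s &, injective f}.
  by move=> y z ys zs; apply: fI; rewrite inE ?ys ?zs orbT.
have -> : (f x \in map f s) = (x \in s).
  apply/mapP/idP => [[y ys /fI ->] //|xs]; last by exists x.
  - exact: mem_head.
  - by rewrite inE ys orbT.
by rewrite IH //; case: ifP.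
Qed.

Lemma rot_rot_exists (T : Type) q r (s : seq T) : exists r', rot q (rot r s) = rot r' s.
Proof.
have [rs|rs] := leqP (size s) r; first by exists q; rewrite (rot_oversize rs).
have [qs|qs] := leqP (size s) q.
  by exists r; rewrite rot_oversize // size_rot.
by eexists; apply: rot_add_mod; apply: ltnW.
Qed.

Section Classes.

Variables n m : nat.
Notation X := 'I_(n + m).
Notation c1 := (circle1 n m).
Notation c2 := (circle2 n m).
Implicit Types (D U : {set X}).
Variables (L : eqType) (lam : X -> L) (x0 : X).
Notation color := (color lam x0).
Notation cyclic_runs := (cyclic_runs lam x0).

Definition classes D : {set {set X}} := preim_partition lam D.

Definition class D l : {set X} := [set y in D | l == lam y].

Lemma classesP D U :
  reflect (exists2 x, x \in D & U = class D (lam x)) (U \in classes D).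
Proof. exact: imsetP. Qed.

Lemma cover_classes D : cover (classes D) = D.
Proof. exact: cover_partition (preim_partitionP lam D). Qed.

Lemma mem_class D x y : (y \in class D (lam x)) = (y \in D) && (lam x == lam y).
Proof. by rewrite inE. Qed.

Lemma class_in D x : x \in D -> class D (lam x) \in classes D.
Proof. by move=> xD; apply/classesP; exists x. Qed.

Lemma class_inj D x l : x \in D -> class D (lam x) = class D l -> lam x = l.
Proof.
move=> xD /setP/(_ x); rewrite !inE xD eqxx /= => /esym/eqP; exact: esym.
Qed.

Lemma pblock_classes D x : x \in D -> pblock (classes D) x = class D (lam x).
Proof.
move=> xD; apply: def_pblock; last by rewrite mem_class xD eqxx.
  by have /and3P[] := preim_partitionP lam D.
exact: class_in.
Qed.

Lemma class_color D x : x \in D ->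
  {in D, forall y, (lam y == lam x) = (y \in class D (lam x))}.
Proof. by move=> xD y yD; rewrite mem_class yD eq_sym. Qed.

Lemma classes_remove D U : U \in classes D ->
  classes (D :\: U) = classes D :\ U.
Proof.
case/classesP=> x xD eU; apply/setP => V; rewrite in_setD1.
have memU y : y \in D -> (y \in U) = (lam y == lam x).
  by move=> yD; rewrite eU mem_class yD eq_sym.
have clE y : y \in D -> lam y != lam x -> class (D :\: U) (lam y) = class D (lam y).
  move=> yD yx; apply/setP => z; rewrite !inE.
  case zD : (z \in D); rewrite ?andbF //= memU // andbT.
  by case: eqP => [->|]; rewrite ?andbF ?andbT // (negPf yx).
apply/classesP/andP => [[y]|[VU /classesP[y yD eV]]].
  rewrite in_setD => /andP[yU yD] ->; rewrite memU // in yU.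
  rewrite clE // class_in //; split=> //; apply: contra yU => /eqP.
  by rewrite eU => /(class_inj yD) ->.
have yx : lam y != lam x by apply: contra VU => /eqP e; rewrite eV eU e.
by exists y; rewrite ?clE // in_setD yD memU // yx.
Qed.

Lemma sub_class D l : class D l \subset D.
Proof. by apply/subsetP => x; rewrite inE => /andP[]. Qed.

Section Weight.
Variables (K : comNzRingType) (T : Type).
Variables (psi1 : seq T -> K) (psi2 : seq T -> seq T -> K) (t : X -> T).
Notation weight := (psi_partition psi1 psi2 t).

Definition annular_weight D : K :=
  if annular (classes D) then weight (classes D) else 0.

Lemma annular_weight_arc D U : U \in classes D -> circle_arc D U ->
  annular_weight D = psi1 (map t (enum U)) * annular_weight (D :\: U).
Proof.
move=> UD; rewrite -{1}(cover_classes D) -removableE => rU.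
rewrite /annular_weight classes_remove // -annular_remove //.
by case: ifP => _; rewrite ?mulr0 // -psi_partition_remove.
Qed.

Lemma annular_weight_empty D : D :&: c1 = set0 \/ D :&: c2 = set0 ->
  annular_weight D = 0.
Proof.
move=> D0; rewrite /annular_weight; case: ifP => // /annular_cover.
by rewrite cover_classes => -[/eqP h1 /eqP h2]; case: D0.
Qed.

Lemma annular_irreducible D :
  (forall U, U \in classes D -> ~~ circle_arc D U) ->
  annular (classes D) = irreducible_annular (classes D).
Proof.
move=> noarc; apply/existsP/idP => [[Q /andP[/connectP[[|P p] /=]]]|irr].
- by move=> _ ->.
- case/andP=> /exists_inP[U UD /andP[rU _]].
  by case/negP: (noarc _ UD); rewrite removableE cover_classes in rU.
by exists (classes D); rewrite irr connect0.
Qed.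

Lemma annular_weight_one D : classes D = [set D] ->
  D :&: c1 != set0 -> D :&: c2 != set0 ->
  annular_weight D =
  psi2 (map t (enum (D :&: c1))) (map t (enum (D :&: c2))).
Proof.
move=> eD D1 D2.
have cD : cover (classes D) = D by rewrite cover_classes.
have cons c : consecutive (D :&: c) (D :&: c).
  apply/consecutiveP; exists 0%N, (enum (D :&: c)), [::].
  by rewrite rot0 cats0; split=> // x; rewrite mem_enum.
have noarc : ~~ circle_arc D D.
  apply/negP => /orP[] /andP[/subsetP sD _].
    case/set0Pn: D2 => x; rewrite in_setI circle2E => /andP[/sD ->] //.
  case/set0Pn: D1 => x; rewrite in_setI => /andP[/sD].
  by rewrite circle2E => /negPf->.
have irr : irreducible_annular (classes D).
  apply/and5P; split; rewrite ?cD //.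
  - by apply/forall_inP => U UD; rewrite removableE cD; move: UD; rewrite eD => /set1P ->.
  - apply/forall_inP => U UD; have -> : U = D by apply/set1P; rewrite -eD.
    by rewrite D1 D2 !cons.
  have pb x : x \in D -> pblock (classes D) x = D.
    by move=> xD; rewrite pblock_classes //; apply/set1P; rewrite -eD class_in.
  have al c : D :&: c != set0 -> blocks_along (classes D) c = [:: D].
    move=> /set0Pn[x xD]; rewrite /blocks_along cD.
    have -> : map (pblock (classes D)) (enum (D :&: c)) = nseq (size (enum (D :&: c))) D.
      rewrite -(size_map (pblock (classes D))); apply/all_pred1P/allP => _ /mapP[y + ->].
      by rewrite mem_enum /= => /setIP[yD _]; rewrite pb.
    have : (0 < size (enum (D :&: c)))%N.
      by rewrite -cardE; apply/card_gt0P; exists x.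
    by case: (size _) => // k _; elim: k => //= k ->; rewrite mem_head.
  by apply/existsP; exists ord0; rewrite !al.
rewrite /annular_weight ifT; last first.
  by apply/existsP; exists (classes D); rewrite irr connect0.
have tD : is_through D by rewrite /is_through D1 D2.
rewrite /weight eD big_set1 /psi_block tD /=.
have -> : through_blocks [set D] = [set D].
  by apply/setP => U; rewrite !inE; case: eqP => [->|].
by rewrite cards1 eqxx.
Qed.

End Weight.

Lemma mem_colors D c a l : cyclic_runs (enum (D :&: c)) a ->
  reflect (exists2 x, x \in D :&: c & lam x = l) (l \in map color a).
Proof.
move=> rs; have ra : all (run lam x0) a by case: rs => -[].
have memE x : (x \in D :&: c) = (x \in flatten a).
  by case: rs => _ [k ->]; rewrite mem_rot mem_enum.
apply: (iffP mapP) => [[g ga ->]|[x + <-]].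
  exists (head x0 g) => //; rewrite memE; apply/flattenP; exists g => //.
  by have := run_neq0 (allP ra _ ga); case: (g) => //= *; rewrite mem_head.
rewrite memE => /flattenP[g ga xg]; exists g => //.
exact: run_color (allP ra _ ga) xg.
Qed.

Lemma blocks_alongE D c a : cyclic_runs (enum (D :&: c)) a ->
  undup (map lam (enum (D :&: c))) = map color a ->
  blocks_along (classes D) c = map (class D) (map color a).
Proof.
move=> ra ua; rewrite /blocks_along cover_classes -ua.
rewrite -undup_map_in; last first.
  move=> l l' /mapP[x + ->] /mapP[y + ->]; rewrite !mem_enum => /setIP[xD _] _.
  exact: class_inj.
rewrite -map_comp; congr undup; apply/eq_in_map => x; rewrite mem_enum.
by move=> /setIP[xD _]; apply: pblock_classes.
Qed.

Lemma run_arc s a j : cyclic_runs s a -> (j < size a)%N ->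
  exists r v, [/\ rot r s = nth [::] a j ++ v, nth [::] a j != [::]
                & (1 < size a)%N -> v != [::]].
Proof.
move=> [[ra _] [k fa]] ja; pose w := drop j.+1 a ++ take j a.
have [r er] := rot_rot_exists (size (flatten (take j a))) k s.
have ea : a = take j a ++ nth [::] a j :: drop j.+1 a.
  by rewrite -drop_nth // cat_take_drop.
exists r, (flatten w); split.
- rewrite -er -fa {2}ea flatten_cat rot_size_cat /= -catA.
  by rewrite /w flatten_cat.
- by apply/run_neq0/(allP ra)/mem_nth.
have sw : size w = (size a).-1.
  rewrite size_cat size_drop size_takel ?(ltnW ja) //; lia.
have rw : all (run lam x0) w.
  by apply/allP => g gw; apply: (allP ra); rewrite ea mem_cat inE; move: gw;
    rewrite mem_cat => /orP[->|->]; rewrite ?orbT.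
move=> a1; case: w sw rw => [|g w] /= sw; first by move: sw a1; case: (size a) => [|[]].
by case/andP => /run_neq0; case: g.
Qed.

Lemma class_run D c a j : cyclic_runs (enum (D :&: c)) a -> uniq (map color a) ->
  (j < size a)%N -> class D (color (nth [::] a j)) :&: c =i nth [::] a j.
Proof.
move=> [[ra _] [k fa]] ua ja x.
have memE : (x \in D :&: c) = (x \in flatten a).
  by rewrite fa mem_rot mem_enum.
rewrite inE inE andbAC -in_setI memE; apply/andP/idP => [[]|xj].
  case/flattenP=> g /(nthP [::])[i ia <-] xi /eqP cj; suff -> : j = i by [].
  apply/eqP; rewrite -(nth_uniq (lam x0) _ _ ua) ?size_map // !(nth_map [::]) //.
  by rewrite cj (run_color (allP ra _ (mem_nth [::] ia)) xi).
have ga := mem_nth [::] ja; split; first by apply/flattenP; exists (nth [::] a j).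
by rewrite (run_color (allP ra _ ga) xj).
Qed.

Lemma class_consecutive D c a l : cyclic_runs (enum (D :&: c)) a ->
  uniq (map color a) -> l \in map color a ->
  consecutive (D :&: c) (class D l :&: c).
Proof.
move=> ra ua /mapP[g /(nthP [::])[j ja <-] ->]; apply/consecutiveP.
have [r [v [er _ _]]] := run_arc ra ja.
by exists r, (nth [::] a j), v; split=> // x; rewrite (class_run ra).
Qed.

Section Matching.

Variables (D : {set X}) (a b : seq (seq X)).
Hypothesis runs1 : cyclic_runs (enum (D :&: c1)) a.
Hypothesis runs2 : cyclic_runs (enum (D :&: c2)) b.
Hypothesis undup1 : uniq (map color a) ->
  undup (map lam (enum (D :&: c1))) = map color a.
Hypothesis undup2 : uniq (map color b) ->
  undup (map lam (enum (D :&: c2))) = map color b.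

Definition spoke (k j : 'I_(size a)) : seq X :=
  nth [::] b (iter k (@ordS (size a)) (rev_ord j)).

Definition matched (k : 'I_(size a)) : bool :=
  [forall j : 'I_(size a), color (nth [::] a j) == color (spoke k j)].

(** The intersection of a block with a circle is an arc, hence one run, so that
    the blocks along a circle are the colors of its runs, each occurring once. *)
Lemma irreducible_matched : irreducible_annular (classes D) ->
  [/\ uniq (map color a), size a = size b & exists k, matched k].
Proof.
case/and5P=> _; rewrite cover_classes => D1 D2 /forall_inP arcs /existsP[r /eqP al].
have uniq_colors c s : cyclic_runs (enum (D :&: c)) s ->
    (forall U, U \in classes D -> consecutive (D :&: c) (U :&: c)) ->
    uniq (map color s).
  move=> rs cs; apply/(uniqP (lam x0)) => k k'.
  rewrite !inE size_map => ks ks'; rewrite !(nth_map [::]) // => ekk'.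
  have : color (nth [::] s k) \in map color s by rewrite map_f // mem_nth.
  case/(mem_colors _ rs) => x /setIP[xD _] ex.
  apply: (consecutive_one_run rs (cs _ (class_in xD))) (ks) (ks') (erefl _) (esym ekk').
  by move=> y /setIP[yD yc]; rewrite in_setI yc andbT -ex -class_color.
have u1 : uniq (map color a).
  by apply: (uniq_colors c1) => // U /arcs/and4P[].
have u2 : uniq (map color b).
  by apply: (uniq_colors c2) => // U /arcs/and4P[].
have ab : map color a =i map color b.
  move=> l; apply/(mem_colors _ runs1)/(mem_colors _ runs2) => -[x /setIP[xD xc] <-].
    have /and4P[_ /set0Pn[y yU] _ _] := arcs _ (class_in xD).
    move: yU; rewrite in_setI mem_class => /andP[/andP[yD /eqP ->] yc].
    by exists y; rewrite // in_setI yD.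
  have /and4P[/set0Pn[y yU] _ _ _] := arcs _ (class_in xD).
  move: yU; rewrite in_setI mem_class => /andP[/andP[yD /eqP ->] yc].
  by exists y; rewrite // in_setI yD.
have sab : size a = size b.
  by rewrite -(size_map color a) -(size_map color b) (perm_size (uniq_perm u1 u2 ab)).
split=> //.
rewrite (blocks_alongE runs1 (undup1 u1)) (blocks_alongE runs2 (undup2 u2)) in al.
rewrite -map_rev -map_rot in al.
have al' : map color a = rot r (rev (map color b)).
  apply: (@inj_in_map _ _ (class D) (mem (map color a))) al.
  - move=> l l' /(mem_colors _ runs1)[x /setIP[xD _] <-] _; exact: class_inj.
  - by apply/allP => l.
  - by apply/allP => l; rewrite mem_rot mem_rev /= ab.
have sb : size (map color b) = size a by rewrite size_map.
have [k hk] := rot_rev_nth (lam x0) sb (size_runs1 runs1 D1) al'.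
exists k; apply/forallP => j; apply/eqP; have := hk j.
by rewrite !(nth_map [::]) // -sab.
Qed.

Lemma matched_sub k : size a = size b -> matched k ->
  perm_eq (map color a) (map color b).
Proof.
move=> sab /forallP mk.
rewrite (@nth_rot_revP _ (lam x0) (map color a) (map color b) (size a) k).
- by rewrite perm_rot perm_rev.
- by rewrite size_map.
- by rewrite size_map.
by move=> j; rewrite !(nth_map [::]) // -?sab //; apply/eqP/mk.
Qed.

(** Every color of the second circle occurs on the first one, so that the colors
    of the runs [a] number the classes. *)
Lemma classesE : perm_eq (map color a) (map color b) ->
  perm_eq (enum (classes D)) (map (class D) (undup (map color a))).
Proof.
move=> /perm_mem pab; apply: uniq_perm; first exact: enum_uniq.
  rewrite map_inj_in_uniq ?undup_uniq // => l l'.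
  rewrite !mem_undup => /(mem_colors _ runs1)[x /setIP[xD _] <-] _.
  exact: class_inj.
move=> U; rewrite mem_enum; apply/classesP/mapP => [[x xD ->]|[l + ->]].
  exists (lam x) => //; rewrite mem_undup.
  have [x1|x1] := boolP (x \in c1).
    by apply/(mem_colors _ runs1); exists x; rewrite // in_setI xD.
  rewrite pab; apply/(mem_colors _ runs2); exists x => //.
  by rewrite in_setI xD circle2E.
rewrite mem_undup => /(mem_colors _ runs1)[x /setIP[xD _] <-].
by exists x.
Qed.

Lemma card_classes : perm_eq (map color a) (map color b) ->
  #|classes D| = size (undup (map color a)).
Proof. by move=> /classesE/perm_size; rewrite -cardE size_map. Qed.

Lemma matched_through k U : size a = size b -> matched k -> U \in classes D ->
  is_through U.
Proof.
move=> sab mk UD; have pab := matched_sub sab mk.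
have : U \in map (class D) (undup (map color a)).
  by rewrite -(perm_mem (classesE pab)) mem_enum.
case/mapP=> l; rewrite mem_undup => la ->.
have lb : l \in map color b by rewrite -(perm_mem pab).
apply/andP; split; apply/set0Pn.
  case/(mem_colors _ runs1): la => x /setIP[xD x1] <-.
  by exists x; rewrite in_setI mem_class xD eqxx.
case/(mem_colors _ runs2): lb => x /setIP[xD x1] <-.
by exists x; rewrite in_setI mem_class xD eqxx.
Qed.

Lemma uniq_colors2 k : size a = size b -> matched k -> uniq (map color a) ->
  uniq (map color b).
Proof. by move=> sab mk; rewrite (perm_uniq (matched_sub sab mk)). Qed.

Lemma matched_irreducible k :
  (forall U, U \in classes D -> ~~ circle_arc D U) ->
  D :&: c1 != set0 -> D :&: c2 != set0 ->
  size a = size b -> uniq (map color a) -> matched k ->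
  irreducible_annular (classes D).
Proof.
move=> noarc D1 D2 sab u1 mk; have u2 := uniq_colors2 sab mk u1.
have pab := matched_sub sab mk.
apply/and5P; split; rewrite ?cover_classes //.
- by apply/forall_inP => U UD; rewrite removableE cover_classes noarc.
- apply/forall_inP => U UD; have /andP[-> ->] := matched_through sab mk UD.
  have : U \in map (class D) (map color a).
    by rewrite -(undup_id u1) -(perm_mem (classesE pab)) mem_enum.
  case/mapP=> l la eU; have lb : l \in map color b by rewrite -(perm_mem pab).
  by rewrite eU (class_consecutive runs1 u1 la) (class_consecutive runs2 u2 lb).
rewrite (blocks_alongE runs1 (undup1 u1)) (blocks_alongE runs2 (undup2 u2)).
have rp : (size a - k < #|classes D|.+1)%N.
  by rewrite card_classes // undup_id // size_map ltnS leq_subr.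
apply/existsP; exists (Ordinal rp) => /=; rewrite -map_rev -map_rot.
apply/eqP; congr map; apply: (@nth_rot_revP _ (lam x0)).
- by rewrite size_map.
- by rewrite size_map.
by move=> j; rewrite !(nth_map [::]) // -?sab //; apply/eqP/(forallP mk).
Qed.

Lemma matched_weight k (K : comNzRingType) (T : Type)
  (psi1 : seq T -> K) (psi2 : seq T -> seq T -> K) (t : X -> T) :
  (1 < size a)%N -> size a = size b -> uniq (map color a) -> matched k ->
  psi_partition psi1 psi2 t (classes D) =
  \prod_(j < size a) psi1 (map t (nth [::] a j ++ spoke k j)).
Proof.
move=> a1 sab u1 mk; have u2 := uniq_colors2 sab mk u1.
have pab := matched_sub sab mk.
have thr : through_blocks (classes D) = classes D.
  apply/setP => U; rewrite inE; case UD : (U \in classes D) => //=.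
  exact: matched_through mk UD.
rewrite /psi_partition -big_enum (perm_big _ (classesE pab)) /= undup_id //.
rewrite !big_map (big_nth [::]) big_mkord; apply: eq_bigr => j _.
have UD : class D (color (nth [::] a j)) \in classes D.
  rewrite -mem_enum (perm_mem (classesE pab)) undup_id //.
  by apply: map_f; rewrite map_f ?mem_nth.
rewrite /psi_block (matched_through sab mk UD) thr card_classes // undup_id //.
rewrite size_map gtn_eqF //= /through_cycle thr cover_classes.
have [r1 [v1 [e1 g1 /(_ a1) n1]]] := run_arc runs1 (ltn_ord j).
pose j' := iter k (@ordS (size a)) (rev_ord j).
have jb : (j' < size b)%N by rewrite -sab.
have [r2 [v2 [e2 g2 n2]]] := run_arc runs2 jb.
rewrite -sab in n2; have {}n2 := n2 a1.
rewrite (from_first_arc e1) ?(from_first_arc e2) //.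
  move=> x; have -> : color (nth [::] a j) = color (nth [::] b j').
    exact/eqP/(forallP mk).
  exact: class_run runs2 u2 jb x.
exact: class_run runs1 u1 (ltn_ord j).
Qed.


(** With distinct colors at most one rotation matches the runs, so that the sum
    has at most one term. *)
Lemma annular_weight_matched (K : comNzRingType) (T : Type)
  (psi1 : seq T -> K) (psi2 : seq T -> seq T -> K) (t : X -> T) :
  (forall U, U \in classes D -> ~~ circle_arc D U) ->
  D :&: c1 != set0 -> D :&: c2 != set0 -> (1 < size a)%N -> size a = size b ->
  annular_weight psi1 psi2 t D =
  \sum_(k < size a | matched k && uniq (map color a))
     \prod_(j < size a) psi1 (map t (nth [::] a j ++ spoke k j)).
Proof.
move=> noarc D1 D2 a1 sab; rewrite /annular_weight annular_irreducible //.
have [k /andP[mk u1]|no] := pickP (fun k => matched k && uniq (map color a)).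
  have -> : irreducible_annular (classes D) by apply: matched_irreducible mk.
  rewrite (matched_weight psi1 psi2 t a1 sab u1 mk); symmetry; apply: big_pred1 => k' /=.
  rewrite u1 andbT; apply/idP/eqP => [mk'|->] //.
  have u2 := uniq_colors2 sab mk u1.
  pose j := Ordinal (ltnW a1).
  have ekk : color (spoke k' j) = color (spoke k j).
    by rewrite -(eqP (forallP mk j)) (eqP (forallP mk' j)).
  have {}ekk : iter k' (@ordS (size a)) (rev_ord j) =
      iter k (@ordS (size a)) (rev_ord j) :> nat.
    apply/eqP; rewrite -(nth_uniq (lam x0) _ _ u2) ?size_map -?sab //.
    by rewrite !(nth_map [::]) -?sab //; apply/eqP.
  apply: val_inj => /=; rewrite !iter_ordS /= in ekk.
  move/eqP: ekk; rewrite -[(_ == _ %% _)%N]/(_ == _ %[mod _])%N eqn_modDl !modn_small //.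
  by move/eqP.
rewrite big_pred0 //; case: ifP => // /irreducible_matched[u1 _ [k mk]].
by have := no k; rewrite mk u1.
Qed.

Lemma annular_weight_unmatched (K : comNzRingType) (T : Type)
  (psi1 : seq T -> K) (psi2 : seq T -> seq T -> K) (t : X -> T) :
  (forall U, U \in classes D -> ~~ circle_arc D U) -> (1 < #|classes D|)%N ->
  (size a <= 1)%N \/ size a <> size b ->
  annular_weight psi1 psi2 t D = 0.
Proof.
move=> noarc cD ab; rewrite /annular_weight annular_irreducible //.
case: ifP => // /irreducible_matched[u1 sab [k mk]]; case: ab => // a1.
move: cD; rewrite card_classes ?(matched_sub sab mk) // undup_id // size_map.
by rewrite ltnNge a1.
Qed.

(** A class with a single run lies on one circle, and there the run is an arc. *)
Lemma two_runs z : ~~ circle_arc D (class D (color (run_at z))) ->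
  exists2 z' : 'I_(size a) + 'I_(size b), z' != z & color (run_at z') = color (run_at z).
Proof.
move=> noarc; have [z' /andP[zz /eqP cz]|alone] :=
  pickP (fun z' => (z' != z) && (color (@run_at n m a b z') == color (run_at z))).
  by exists z'.
case/negP: noarc.
have eU : class D (color (run_at z)) =i run_at z.
  move=> x; rewrite inE; apply/andP/idP => [[xD /eqP cx]|xz]; last first.
    by rewrite (run_at_sub runs1 runs2 xz) (run_at_color runs1 runs2 xz).
  have [z' xz'] := run_at_cover runs1 runs2 xD.
  have := alone z'; rewrite -(run_at_color runs1 runs2 xz') cx eqxx andbT.
  by move/negbFE/eqP <-.
have cons c s j : cyclic_runs (enum (D :&: c)) s -> (j < size s)%N ->
    class D (color (run_at z)) =i nth [::] s j ->
    consecutive (D :&: c) (class D (color (run_at z))).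
  move=> rs js es; have [r [v [er _ _]]] := run_arc rs js.
  by apply/consecutiveP; exists r, (nth [::] s j), v.
case: z {alone} eU cons => j eU cons; apply/orP; [left|right]; apply/andP; split.
- by apply/subsetP => x; rewrite eU => /(mem_run_at1 runs1)/setIP[].
- exact: cons runs1 (ltn_ord j) eU.
- by apply/subsetP => x; rewrite eU => /(mem_run_at2 runs2)/setIP[].
- exact: cons runs2 (ltn_ord j) eU.
Qed.

(** Removing runs loses fewer classes than runs, because a class disappears
    only with all of its runs, which are at least two. *)
Lemma card_classes_drop (Z : {set 'I_(size a) + 'I_(size b)}) :
  (forall U, U \in classes D -> ~~ circle_arc D U) -> Z != set0 ->
  (#|classes D| < #|classes (D :\: points Z)| + #|Z|)%N.
Proof.
move=> noarc /set0Pn[z1 z1Z].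
(* The classes that disappear; each of them has a run in [Z] other than [z1]. *)
pose lost := [set U in classes D | U \subset points Z].
pose f (z : 'I_(size a) + 'I_(size b)) := class D (color (run_at z)).
have f_in z : f z \in classes D.
  rewrite /f -(run_at_color runs1 runs2 (head_run_at runs1 runs2 z)).
  exact/class_in/(run_at_sub runs1 runs2 (head_run_at runs1 runs2 z)).
have lostZ z : f z \in lost -> z \in Z.
  rewrite inE => /andP[_ /subsetP sU].
  have hz := head_run_at runs1 runs2 z.
  have /sU/pointsP[z' z'Z hz'] : head x0 (run_at z) \in f z.
    by rewrite inE (run_at_sub runs1 runs2 hz) eqxx.
  by rewrite (run_at_inj runs1 runs2 hz hz').
have sub : lost \subset f @: (Z :\ z1).
  apply/subsetP => U Ul; move: (Ul); rewrite inE => /andP[/classesP[x xD eU] _].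
  have [z xz] := run_at_cover runs1 runs2 xD.
  have fz : f z = U by rewrite eU (run_at_color runs1 runs2 xz).
  have [ez|nz] := eqVneq z z1; last first.
    by apply/imsetP; exists z; rewrite // in_setD1 nz lostZ ?fz.
  have [z' zz' cz'] := two_runs (noarc _ (f_in z)).
  apply/imsetP; exists z'; last by rewrite -fz /f cz'.
  by rewrite in_setD1 -{1}ez zz' lostZ // /f cz' -/(f z) fz.
have lostc : (#|lost| < #|Z|)%N.
  rewrite [X in (_ < X)%N](cardsD1 z1) z1Z ltnS.
  by apply: leq_trans (subset_leq_card sub) (leq_imset_card _ _).
rewrite -(cardsID lost (classes D)).
have -> : classes D :&: lost = lost.
  by apply/setIidPr/subsetP => U; rewrite inE => /andP[].
rewrite addnC -addnS leq_add //.
pose g U := U :\: points Z.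
have elt U : U \in classes D :\: lost ->
    exists x, [/\ x \in D, x \notin points Z & U = class D (lam x)].
  rewrite in_setD inE; case UD : (U \in classes D) => //=; rewrite andbT.
  case/subsetPn=> x xU xZ; exists x; case/classesP: UD xU => y yD ->.
  by rewrite mem_class => /andP[xD /eqP <-].
rewrite -(@card_in_imset _ _ g).
  apply: subset_leq_card; apply/subsetP => _ /imsetP[U /elt[x [xD xZ ->]] ->].
  apply/classesP; exists x; first by rewrite in_setD xZ.
  by apply/setP => y; rewrite in_setD !mem_class in_setD andbA.
move=> U V /elt[x [xD xZ ->]] /elt[y [yD yZ ->]] /setP/(_ x).
rewrite !in_setD xZ !mem_class xD eqxx /= => /esym/eqP ->.
by [].
Qed.

End Matching.
End Classes.

(** * Convergence of complex sequences *)

Section ComplexLimits.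

Local Open Scope classical_set_scope.
Variable R : realType.
Implicit Types (u v : nat -> R[i]) (l : R[i]).

(** An inductive wrapper, so that unification never unfolds a convergence into
    filters. *)
Variant converges u l : Prop :=
  Converges of (u : nat -> R[i]^o) @ \oo --> (l : R[i]^o).

Notation "u ~> l" := (converges u l) (at level 70).

Lemma cvg_invS : (fun N => N.+1%:R^-1 : R[i]) ~> 0.
Proof.
split; apply/(@cvgrPdist_lt _ R[i]^o) => eps eps0.
have [eI eR] : complex.Im eps = 0 /\ 0 < complex.Re eps.
  by move: eps0; rewrite ltcE /= => /andP[/eqP -> ->].
have := @cvg_harmonic R => /cvgrPdist_lt/(_ (complex.Re eps) eR).
apply: filterS => N; rewrite !sub0r !normrN.
rewrite !ger0_norm ?invr_ge0 ?ler0n // => h.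
rewrite ltcE eI.
have -> : (N.+1%:R^-1 : R[i]) = (N.+1%:R^-1)%:C.
  by rewrite -(rmorph_nat (real_complex R)) -fmorphV.
by rewrite /= eqxx.
Qed.

Lemma cvgi_cst l : (fun _ => l) ~> l.
Proof. by split; exact: cvg_cst. Qed.

Lemma cvgi_mul u v l l' : u ~> l -> v ~> l' -> (fun N => u N * v N) ~> l * l'.
Proof. case=> ul; case=> vl; split; exact: (cvgM ul vl). Qed.

Lemma cvgi_add u v l l' : u ~> l -> v ~> l' -> (fun N => u N + v N) ~> l + l'.
Proof. case=> ul; case=> vl; split; exact: (@cvgD _ R[i]^o _ _ _ _ _ _ _ ul vl). Qed.

Lemma cvgi_opp u l : u ~> l -> (fun N => - u N) ~> - l.
Proof. case=> ul; split; exact: (@cvgN _ R[i]^o _ _ _ _ _ ul). Qed.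

Lemma cvgi_near N0 u v l : u ~> l -> (forall N, (N0 <= N)%N -> u N = v N) -> v ~> l.
Proof.
case=> ul uv; split; apply: cvg_trans ul; apply: near_eq_cvg.
by exists N0 => // N /uv ->.
Qed.

Lemma cvgi_ext u v l : u ~> l -> (forall N, u N = v N) -> v ~> l.
Proof. by move=> ul uv; apply: (cvgi_near (N0 := 0)) ul _ => N _. Qed.

Lemma cvgi_sum (I : Type) (r : seq I) (P : pred I)
    (u : I -> nat -> R[i]) (l : I -> R[i]) :
  (forall i, P i -> u i ~> l i) ->
  (fun N => \sum_(i <- r | P i) u i N) ~> \sum_(i <- r | P i) l i.
Proof.
move=> ul; elim: r => [|i r IH].
  rewrite big_nil; apply: (cvgi_ext (cvgi_cst _)) => N.
  by rewrite big_nil.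
rewrite big_cons; have [Pi|nPi] := boolP (P i).
  by apply: (cvgi_ext (cvgi_add (ul _ Pi) IH)) => N; rewrite big_cons Pi.
by apply: (cvgi_ext IH) => N; rewrite big_cons (negPf nPi).
Qed.

Lemma cvgi_prod (I : Type) (r : seq I) (P : pred I)
    (u : I -> nat -> R[i]) (l : I -> R[i]) :
  (forall i, P i -> u i ~> l i) ->
  (fun N => \prod_(i <- r | P i) u i N) ~> \prod_(i <- r | P i) l i.
Proof.
move=> ul; elim: r => [|i r IH].
  rewrite big_nil; apply: (cvgi_ext (cvgi_cst _)) => N.
  by rewrite big_nil.
rewrite big_cons; have [Pi|nPi] := boolP (P i).
  by apply: (cvgi_ext (cvgi_mul (ul _ Pi) IH)) => N; rewrite big_cons Pi.
by apply: (cvgi_ext IH) => N; rewrite big_cons (negPf nPi).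
Qed.

Lemma cvgi_invX d : (0 < d)%N -> (fun N => N.+1%:R^-1 ^+ d : R[i]) ~> 0.
Proof.
case: d => // d _; elim: d => [|d IH]; first exact: cvg_invS.
rewrite -(mul0r (0 : R[i])).
by apply: (cvgi_ext (cvgi_mul cvg_invS IH)) => N; rewrite -exprS.
Qed.

End ComplexLimits.

Local Notation "u ~> l" := (converges u l) (at level 70).

(** * The limit of the correlations with a given kernel *)

Section WordLimits.

Variables (R : realType) (A : nat -> second_order_space R).
Variable B : forall N : nat, 'I_N -> {pred A N}.
Variables (T : Type) (q : forall N : nat, 'I_N -> T -> A N).
Variables (psi1 : seq T -> R[i]) (psi2 : seq T -> seq T -> R[i]).
Hypothesis B_subalg : forall (N : nat) (i : 'I_N), GRing.subalg_closed (B i).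
Hypothesis B_free : forall N : nat, free_second_order (@B N).
Hypothesis q_in : forall (N : nat) (i : 'I_N) (t : T), q i t \in B i.
Hypothesis phi_limit : forall (s : seq T) (i : forall N : nat, 'I_N.+1),
  (0 < size s)%N ->
  (fun N => N.+1%:R * phi (\prod_(x <- s) q (i N) x)) ~> psi1 s.
Hypothesis rho_limit : forall (s s' : seq T) (i : forall N : nat, 'I_N.+1),
  (0 < size s)%N -> (0 < size s')%N ->
  (fun N => N.+1%:R * rho (\prod_(x <- s) q (i N) x) (\prod_(x <- s') q (i N) x))
    ~> psi2 s s'.
Variables n m : nat.
Notation X := 'I_(n + m).
Notation c1 := (circle1 n m).
Notation c2 := (circle2 n m).
Variables (t : X -> T) (L : eqType) (lam : X -> L) (i : forall N, X -> 'I_N.+1).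
Variables (x0 : X) (N0 : nat).
Hypothesis i_lam : forall N x y, lam x = lam y -> i N x = i N y.
Hypothesis i_inj : forall N x y, (N0 <= N)%N -> (i N x == i N y) = (lam x == lam y).
Implicit Types (D U : {set X}).

Notation color := (color lam x0).
Notation run := (run lam x0).
Let e N x : A N.+1 := q (i N x) (t x).

Let e_in N x : e N x \in B (i N x).
Proof. exact: q_in. Qed.

Lemma word_limit l s : s != [::] -> {in s, forall x, lam x = l} ->
  (fun N => N.+1%:R * phi (word (e N) s)) ~> psi1 (map t s).
Proof.
case: s => // x s _ sl.
apply: (cvgi_ext (phi_limit (fun N => i N x) (s := map t (x :: s)) isT)) => N.
congr (_ * phi _); rewrite big_map; apply: eq_big_seq => y ys.
by rewrite /e (@i_lam N y x) // !sl ?mem_head.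
Qed.

Lemma pair_limit l s s' : s != [::] -> s' != [::] ->
  {in s, forall x, lam x = l} -> {in s', forall x, lam x = l} ->
  (fun N => N.+1%:R * rho (word (e N) s) (word (e N) s'))
    ~> psi2 (map t s) (map t s').
Proof.
case: s => // x s _; case: s' => // x' s' _ sl sl'.
apply: (cvgi_ext (rho_limit (fun N => i N x) (s := map t (x :: s))
  (s' := map t (x' :: s')) isT isT)) => N.
congr (_ * rho _ _); rewrite big_map; apply: eq_big_seq => y ys.
  by rewrite /e (@i_lam N y x) // !sl ?mem_head.
by rewrite /e (@i_lam N y x) // sl' // sl ?mem_head.
Qed.

Lemma run_limit g : run g ->
  (fun N => N.+1%:R * phi (word (e N) g)) ~> psi1 (map t g).
Proof.
move=> rg; apply: (@word_limit (color g)) => [|x xg]; first exact: run_neq0 rg.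
exact: run_color rg xg.
Qed.

(** Centring changes the moment by a product of two expectations, which is
    $O(1/N^2)$. *)
Lemma centered_pair_limit g h : run g -> run h -> color g = color h ->
  (fun N => N.+1%:R * phi (cen (word (e N) g) * cen (word (e N) h)))
    ~> psi1 (map t (g ++ h)).
Proof.
move=> rg rh gh.
have gh_lim : (fun N => N.+1%:R * phi (word (e N) (g ++ h))) ~> psi1 (map t (g ++ h)).
  apply: (@word_limit (color g)); first by case: (g) (run_neq0 rg).
  move=> x; rewrite mem_cat => /orP[xg|xh]; first exact: run_color rg xg.
  by rewrite gh; apply: run_color rh xh.
have err := cvgi_mul (cvgi_mul (run_limit rg) (run_limit rh)) (@cvg_invS R).
rewrite -[psi1 _]subr0 -(mulr0 (psi1 (map t g) * psi1 (map t h))).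
apply: (cvgi_ext (cvgi_add gh_lim (cvgi_opp err))) => N.
rewrite phi_cenM word_cat.
set P := phi _; set G := phi _; set H := phi _.
have : (N.+1%:R : R[i]) != 0 by rewrite pnatr_eq0.
by move: (N.+1%:R : R[i]) => x xN0; field.
Qed.

Let F D N : R[i] := corr (e N) D.

Lemma expr_inv_mul k d N : (k <= d)%N ->
  N.+1%:R ^+ k = N.+1%:R ^+ d * N.+1%:R^-1 ^+ (d - k) :> R[i].
Proof.
move=> kd; have N1 : (N.+1%:R : R[i]) != 0 by rewrite pnatr_eq0.
have -> : N.+1%:R ^+ d = N.+1%:R ^+ (d - k) * N.+1%:R ^+ k :> R[i].
  by rewrite -exprD subnK.
by rewrite mulrAC -exprMn divff // expr1n mul1r.
Qed.

Section TwoCircles.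

Variables (D : {set X}) (a b : seq (seq X)).
Hypothesis runs1 : cyclic_runs lam x0 (enum (D :&: c1)) a.
Hypothesis runs2 : cyclic_runs lam x0 (enum (D :&: c2)) b.
Hypothesis undup1 : uniq (map color a) ->
  undup (map lam (enum (D :&: c1))) = map color a.
Hypothesis undup2 : uniq (map color b) ->
  undup (map lam (enum (D :&: c2))) = map color b.
Hypothesis noarc : forall U, U \in classes lam D -> ~~ circle_arc D U.
Hypothesis D1 : D :&: c1 != set0.
Hypothesis D2 : D :&: c2 != set0.
Hypothesis two_classes : (1 < #|classes lam D|)%N.

Let run1 (j : 'I_(size a)) : run (nth [::] a j).
Proof. exact: run_at_run runs1 runs2 (inl j). Qed.

Let run2 (j : 'I_(size b)) : run (nth [::] b j).
Proof. exact: run_at_run runs1 runs2 (inr j). Qed.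

(** A matching with [p] pairs is of order $N^{-p}$, and there are at most [p]
    classes, with equality when the pairs have distinct colors. *)
Lemma spoke_limit (k : 'I_(size a)) : size a = size b ->
  (fun N => N.+1%:R ^+ #|classes lam D| * \prod_(j < size a)
     phi (cen (word (e N) (nth [::] a j)) * cen (word (e N) (spoke b k j))))
  ~> (if matched lam x0 b k && uniq (map color a)
      then \prod_(j < size a) psi1 (map t (nth [::] a j ++ spoke b k j)) else 0).
Proof.
move=> sab; have sb (j : 'I_(size a)) : (iter k (@ordS (size a)) (rev_ord j) < size b)%N.
  by rewrite -sab.
have [mk|] := boolP (matched lam x0 b k) => /=.
  have pab := matched_sub sab mk.
  have cl : (#|classes lam D| <= size a)%N.
    by rewrite (card_classes runs1 runs2 pab) (leq_trans (size_undup _)) ?size_map.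
  have lim : (fun N => \prod_(j < size a) (N.+1%:R *
      phi (cen (word (e N) (nth [::] a j)) * cen (word (e N) (spoke b k j))))) ~>
      \prod_(j < size a) psi1 (map t (nth [::] a j ++ spoke b k j)).
    apply: cvgi_prod => j _; apply: centered_pair_limit => //.
      exact: run2 (Ordinal (sb j)).
    exact/eqP/(forallP mk).
  have eN N : N.+1%:R ^+ #|classes lam D| * \prod_(j < size a)
       phi (cen (word (e N) (nth [::] a j)) * cen (word (e N) (spoke b k j))) =
     \prod_(j < size a) (N.+1%:R *
      phi (cen (word (e N) (nth [::] a j)) * cen (word (e N) (spoke b k j)))) *
      N.+1%:R^-1 ^+ (size a - #|classes lam D|).
    by rewrite (expr_inv_mul N cl) big_split /= prodr_const card_ord mulrAC.
  have [u1|u1] := boolP (uniq (map color a)).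
    apply: (cvgi_ext lim) => N; rewrite eN (card_classes runs1 runs2 pab).
    by rewrite undup_id // size_map subnn expr0 mulr1.
  rewrite -(mulr0 (\prod_(j < size a) psi1 (map t (nth [::] a j ++ spoke b k j)))).
  apply: (cvgi_ext (cvgi_mul lim
    (cvgi_invX _ (d := size a - #|classes lam D|) _))) => [|N].
    rewrite subn_gt0 (card_classes runs1 runs2 pab) -(size_map color a).
    by rewrite ltn_size_undup.
  by rewrite eN.
rewrite negb_forall => /existsP[j cj].
apply: (cvgi_near (N0 := N0) (cvgi_cst 0)) => N NN0.
rewrite (bigD1 j) //= (phi_cen_neq (B_subalg (N := N.+1)) (B_free N.+1)
  (j := i N (head x0 (nth [::] a j))) (k := i N (head x0 (spoke b k j)))).
- by rewrite mul0r mulr0.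
- exact: (word_run (B_subalg (N := N.+1)) (fun x y => i_inj x y NN0) (e_in N) (run1 j)).
- exact: (word_run (B_subalg (N := N.+1)) (fun x y => i_inj x y NN0) (e_in N)
    (run2 (Ordinal (sb j)))).
- by rewrite i_inj.
Qed.

Lemma centered_limit :
  (fun N => N.+1%:R ^+ #|classes lam D| *
     rho (centered_prod (e N) a) (centered_prod (e N) b))
  ~> annular_weight lam psi1 psi2 t D.
Proof.
have [alt1 alt2] : alternating lam x0 a /\ alternating lam x0 b.
  by case: runs1 runs2 => + _ [+ _].
have a0 := size_runs1 runs1 D1; have b0 := size_runs2 runs2 D2.
have [sab|/eqP sab] := eqVneq (size a) (size b); last first.
  rewrite (annular_weight_unmatched runs1 runs2) //; last by right.
  apply: (cvgi_near (N0 := N0) (cvgi_cst 0)) => N NN0.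
  by rewrite (rho_centered_prod_neq (B_subalg (N := N.+1)) (B_free N.+1)
    (fun x y => i_inj x y NN0) (e_in N) (x0 := x0)) ?mulr0.
have [a1|a1] := leqP (size a) 1.
  rewrite (annular_weight_unmatched runs1 runs2) //; last by left.
  apply: (cvgi_near (N0 := N0) (cvgi_cst 0)) => N NN0.
  rewrite (rho_centered_prod_lonely (B_subalg (N := N.+1)) (B_free N.+1)
    (fun x y => i_inj x y NN0) (e_in N) (x0 := x0)) ?mulr0 //.
  have [g ga] : exists g, a = [:: g].
    by move: a0 a1; case: (a) => [//|g [|//]] _ _; exists g.
  have [h hb] : exists h, b = [:: h].
    by move: b0 a1; rewrite sab; case: (b) => [//|h [|//]] _ _; exists h.
  left; exists g; first by rewrite ga mem_head.
  move=> h'; rewrite hb inE => /eqP ->; apply/eqP => gh.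
  have pab : perm_eq (map color a) (map color b) by rewrite ga hb /= gh.
  by have := two_classes; rewrite (card_classes runs1 runs2 pab) ga.
rewrite (annular_weight_matched runs1 runs2) // big_mkcond /=.
apply: (cvgi_near (N0 := N0) (cvgi_sum _ (fun k _ => spoke_limit k sab))) => N NN0.
rewrite -big_distrr /=; congr (_ * _).
by rewrite (rho_centered_prod_eq (B_subalg (N := N.+1)) (B_free N.+1)
    (fun x y => i_inj x y NN0) (e_in N) alt1 alt2 (erefl (size a)) (esym sab) a1).
Qed.

Lemma drop_limit (Z : {set 'I_(size a) + 'I_(size b)}) w : Z != set0 ->
  (fun N => N.+1%:R ^+ #|classes lam (D :\: points Z)| * F (D :\: points Z) N) ~> w ->
  (fun N => N.+1%:R ^+ #|classes lam D| *
    ((\prod_(z in Z) - phi (word (e N) (run_at z))) * F (D :\: points Z) N)) ~> 0.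
Proof.
move=> Z0 lw; have lt := card_classes_drop runs1 runs2 noarc Z0.
have lp : (fun N => \prod_(z in Z) - (N.+1%:R * phi (word (e N) (run_at z)))) ~>
    \prod_(z in Z) - psi1 (map t (run_at z)).
  apply: cvgi_prod => z _; apply: cvgi_opp; apply: run_limit.
  exact: run_at_run runs1 runs2 z.
rewrite -(mulr0 ((\prod_(z in Z) - psi1 (map t (run_at z))) * w)).
have d0 : (0 < #|classes lam (D :\: points Z)| + #|Z| - #|classes lam D|)%N.
  by rewrite subn_gt0.
apply: (cvgi_ext (cvgi_mul (cvgi_mul lp lw) (cvgi_invX _ d0))) => N.
rewrite (expr_inv_mul N (ltnW lt)) exprD.
have -> : \prod_(z in Z) - (N.+1%:R * phi (word (e N) (run_at z))) =
   N.+1%:R ^+ #|Z| * \prod_(z in Z) - phi (word (e N) (run_at z)) :> R[i].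
  under eq_bigr do rewrite -mulrN.
  by rewrite big_split /= prodr_const.
move: (\prod_(z in Z) _) (F _ _) (N.+1%:R ^+ #|Z|) (N.+1%:R^-1 ^+ _) => p f x v.
move: (N.+1%:R ^+ _) => y.
by ring.
Qed.

End TwoCircles.

(** By induction on the number of points: a class that is an arc factors out;
    if there is none, the other terms in the expansion of the centred product
    are negligible, and they concern fewer points. *)
Lemma corr_limit D :
  (fun N => N.+1%:R ^+ #|classes lam D| * F D N) ~> annular_weight lam psi1 psi2 t D.
Proof.
have [k] := ubnP #|D|; elim: k D => // k IH D Dk.
have [D1|D1] := eqVneq (D :&: c1) set0.
  rewrite annular_weight_empty; last by left.
  apply: (cvgi_ext (cvgi_cst 0)) => N.
  by rewrite /F corr_empty ?mulr0 //; left.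
have [D2|D2] := eqVneq (D :&: c2) set0.
  rewrite annular_weight_empty; last by right.
  apply: (cvgi_ext (cvgi_cst 0)) => N.
  by rewrite /F corr_empty ?mulr0 //; right.
have small U : U \subset D -> U != set0 -> (#|D :\: U| < k)%N.
  move=> sU U0; rewrite -ltnS; apply: leq_trans Dk; rewrite ltnS.
  by rewrite -(cardsID U D) (setIidPr sU) -[X in (X < _)%N]add0n ltn_add2r card_gt0.
have [U /andP[UD aU]|noarc] := pickP (fun U => (U \in classes lam D) && circle_arc D U).
  rewrite (annular_weight_arc psi1 psi2 t UD aU).
  have /classesP[x xD eU] := UD.
  have sU : U \subset D by rewrite eU sub_class.
  have xU : x \in U by rewrite eU mem_class xD eqxx.
  have U0 : U != set0 by apply/set0Pn; exists x.
  have lU : (fun N => N.+1%:R * phi (word (e N) (enum U))) ~> psi1 (map t (enum U)).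
    apply: (@word_limit (lam x)).
      by apply/eqP => U'; move: xU; rewrite -mem_enum U'.
    by move=> y; rewrite mem_enum eU mem_class => /andP[_ /eqP].
  apply: (cvgi_near (N0 := N0) (cvgi_mul lU (IH _ (small _ sU U0)))) => N NN0.
  rewrite /F (corr_arc (B_subalg (N := N.+1)) (B_free N.+1) x0
    (fun x y => i_inj x y NN0) (e_in N) sU U0 aU (l := lam x)); last first.
    by rewrite eU; exact: (class_color lam xD).
  rewrite (cardsD1 U (classes lam D)) UD exprS classes_remove //.
  move: (phi _) (corr _ _) (N.+1%:R ^+ _) => p f y.
  by ring.
have {}noarc U : U \in classes lam D -> ~~ circle_arc D U.
  by move=> UD; have := noarc U; rewrite UD => /negbT.
have [x xD1] := set0Pn _ D1; have /setIP[xD _] := xD1.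
have [cl1|cl1] := leqP #|classes lam D| 1.
  have cE : classes lam D = [set class lam D (lam x)].
    apply/esym/eqP; rewrite eqEcard cards1 cl1 andbT sub1set.
    exact: class_in.
  have cD : class lam D (lam x) = D.
    by rewrite -[RHS](cover_classes lam) cE /cover big_set1.
  rewrite cD in cE; rewrite (annular_weight_one psi1 psi2 t cE D1 D2) cE cards1.
  have cx c : {in enum (D :&: c), forall y, lam y = lam x}.
    by move=> y; rewrite mem_enum -{1}cD => /setIP[]; rewrite mem_class => /andP[_ /eqP].
  have en c : D :&: c != set0 -> enum (D :&: c) != [::].
    by apply: contraNneq => e0; rewrite -cards_eq0 cardE e0.
  exact: pair_limit (en _ D1) (en _ D2) (cx _) (cx _).
have [a ra ua] := cyclic_runsP lam x0 (enum (D :&: c1)).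
have [b rb ub] := cyclic_runsP lam x0 (enum (D :&: c2)).
pose tm (Z : {set 'I_(size a) + 'I_(size b)}) N :=
  N.+1%:R ^+ #|classes lam D| *
  ((\prod_(z in Z) - phi (word (e N) (run_at z))) * F (D :\: points Z) N).
have tm0 Z : Z != set0 -> tm Z ~> 0.
  move=> Z0; apply: drop_limit => //; apply: IH.
  rewrite -ltnS; apply: leq_trans Dk; rewrite ltnS.
  have [z zZ] := set0Pn _ Z0; have hz := head_run_at ra rb z.
  apply: (@leq_ltn_trans #|D :\ head x0 (run_at z)|).
    apply: subset_leq_card.
    apply/subsetP => y /setDP[yD yZ]; apply/setD1P; split=> //.
    by apply: contra yZ => /eqP ->; apply/pointsP; exists z.
  by rewrite [X in (_ < X)%N](cardsD1 (head x0 (run_at z))) (run_at_sub ra rb hz) add1n.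
have sum0 := cvgi_sum (index_enum _) (P := fun Z => Z != set0) tm0.
rewrite big1_eq in sum0; rewrite -[annular_weight _ _ _ _ _]subr0.
have lim := centered_limit ra rb ua ub noarc D1 D2 cl1.
apply: (cvgi_ext (cvgi_add lim (cvgi_opp sum0))) => N.
rewrite (corr_expand (e N) ra rb) big_distrr /=.
rewrite [X in X - _](bigD1 set0) //= addrK big_set0 mul1r.
have -> : @points n m a b set0 = set0.
  by apply/setP => y; rewrite in_set0; apply/pointsP => -[z]; rewrite inE.
by rewrite setD0.
Qed.

End WordLimits.

(** * Summation over the index functions *)

(** The permutation is built point by point: a transposition corrects its value
    at a new point and moves none of the values that are already right. *)
Lemma same_kernel_perm (X I : finType) (f g : X -> I) :
  (forall x y, (f x == f y) = (g x == g y)) ->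
  exists pi : {perm I}, forall x, f x = pi (g x).
Proof.
move=> fg; suff [pi h] : exists pi : {perm I}, {in enum X, forall x, f x = pi (g x)}.
  by exists pi => x; rewrite h ?mem_enum.
elim: (enum X) => [|x s [pi IH]]; first by exists 1%g.
have [/hasP[y ys /eqP xy]|/hasPn new] := boolP (has (fun y => g x == g y) s).
  exists pi => z; rewrite inE => /orP[/eqP ->|/IH //].
  have /eqP -> : f x == f y by rewrite fg xy.
  by rewrite IH // xy.
exists (pi * tperm (pi (g x)) (f x))%g => z; rewrite permM inE.
have [-> _|zx /= zs] := eqVneq z x; first by rewrite tpermL.
have nzx := new _ zs.
rewrite tpermD; first exact: IH.
  by rewrite (inj_eq perm_inj).
by rewrite -IH // fg.
Qed.

Section Kernels.

Variables n m : nat.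
Notation X := 'I_(n + m).

Lemma kernel_classes (I L : eqType) (f : X -> I) (g : X -> L) :
  (forall x y, (f x == f y) = (g x == g y)) <->
  classes f [set: X] = classes g [set: X].
Proof.
split=> [fg|fg x y].
  by apply: eq_imset => x; apply/setP => y; rewrite !inE /= fg.
have sub (I1 I2 : eqType) (f1 : X -> I1) (f2 : X -> I2) :
    classes f1 [set: X] = classes f2 [set: X] -> f1 x = f1 y -> f2 x = f2 y.
  move=> e12 exy; have := pblock_classes f2 (in_setT x).
  rewrite -e12 pblock_classes ?in_setT // exy => /setP/(_ y).
  by rewrite !mem_class in_setT eqxx => /esym/eqP.
by apply/eqP/eqP; apply: sub.
Qed.

Lemma classes_pblock (sigma : {set {set X}}) : partition sigma [set: X] ->
  classes (pblock sigma) [set: X] = sigma.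
Proof. exact: preim_partition_pblock. Qed.

(** A function with kernel [sigma] is an injective function on the blocks. *)
Lemma card_kernel (I : finType) (sigma : {set {set X}}) :
  partition sigma [set: X] ->
  #|[set f : {ffun X -> I} | classes f [set: X] == sigma]| = #|I| ^_ #|sigma|.
Proof.
move=> ps; have [/eqP cov triv s0] := and3P ps.
have inS x : pblock sigma x \in enum sigma by rewrite mem_enum pblock_mem // cov.
have rP x : (index (pblock sigma x) (enum sigma) < #|sigma|)%N.
  by rewrite cardE index_mem.
pose r x := Ordinal (rP x).
have r_eq x y : (r x == r y) = (pblock sigma x == pblock sigma y).
  apply/eqP/eqP => [[e]|e]; last by apply: val_inj; rewrite /= e.
  by rewrite -(nth_index set0 (inS x)) e nth_index.
have r_surj j : {x | r x = j}.
  suff: exists x, r x == j by move/sigW => [x /eqP]; exists x.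
  have jU : enum_val j \in sigma by apply: enum_valP.
  have /set0Pn[x xU] : enum_val j != set0 by apply: contraNneq s0 => <-.
  exists x; apply/eqP/val_inj => /=; rewrite (def_pblock triv jU xU).
  by rewrite (enum_val_nth set0) index_uniq ?enum_uniq // -cardE.
have hI : injective (fun J : {ffun 'I_#|sigma| -> I} => [ffun x => J (r x)]).
  move=> J J' /ffunP e; apply/ffunP => j; have [x <-] := r_surj j.
  by have := e x; rewrite !ffunE.
have kerE f : (classes f [set: X] == sigma) <->
    forall x y, (f x == f y :> I) = (r x == r y).
  rewrite -{1}(classes_pblock ps); split=> [/eqP/kernel_classes h x y|h].
    by rewrite h r_eq.
  by apply/eqP/kernel_classes => x y; rewrite h r_eq.
rewrite -[X in _ ^_ X]card_ord -card_inj_ffuns -(card_imset _ hI).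
apply: eq_card => f; rewrite inE; apply/idP/imsetP => [/kerE fr|[J + ->]].
  exists [ffun j => f (sval (r_surj j))].
    rewrite inE; apply/injectiveP => j j'; rewrite !ffunE => /eqP.
    by rewrite fr (svalP (r_surj j)) (svalP (r_surj j')) => /eqP.
  apply/ffunP => x; rewrite !ffunE; apply/eqP; rewrite fr.
  by rewrite (svalP (r_surj (r x))).
rewrite inE => /injectiveP JI; apply/kerE => x y.
by rewrite !ffunE (inj_eq JI).
Qed.

End Kernels.

Lemma ffact_limit (R : realType) k :
  (fun N => (N.+1 ^_ k)%:R * N.+1%:R^-1 ^+ k : R[i]) ~> 1.
Proof.
elim: k => [|k IH].
  by apply: (cvgi_ext (cvgi_cst 1)) => N; rewrite ffactn0 expr0 mulr1.
have factor : (fun N => 1 + k%:R * - N.+1%:R^-1 : R[i]) ~> 1.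
  rewrite -[X in _ ~> X]addr0 -(mulr0 (k%:R : R[i])) -[X in _ * X]oppr0.
  exact: cvgi_add (cvgi_cst 1) (cvgi_mul (cvgi_cst _) (cvgi_opp (@cvg_invS R))).
rewrite -[X in _ ~> X](mulr1 (1 : R[i])).
apply: (cvgi_near (N0 := k) (cvgi_mul IH factor)) => N kN.
rewrite ffactnSr natrM natrB ?(leq_trans kN) // exprSr.
have : (N.+1%:R : R[i]) != 0 by rewrite pnatr_eq0.
move: (N.+1%:R : R[i]) (_ ^_ k)%:R (k%:R : R[i]) => y F l y0.
have -> : 1 + l * - y^-1 = (y - l) * y^-1 by field.
by move: (y^-1) (_ ^+ k) => z Y; ring.
Qed.

Section FullSum.
Variables (R : realType) (A : second_order_space R) (n m r : nat).
Notation X := 'I_(n + m).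

(** The factors need not commute, but both sides run through the points in the
    order of their enumeration. *)
Lemma word_enum (e : X -> A) (D : {set X}) : word e (enum D) = \prod_(x in D) e x.
Proof. by rewrite /word /enum_mem big_filter [index_enum _]unlock. Qed.

Lemma corr_setT (e : X -> A) : corr e [set: X] =
  rho (\prod_(k < n) e (lshift m k)) (\prod_(k < m) e (rshift n k)).
Proof.
rewrite /corr !setTI !word_enum; congr (rho _ _).
  rewrite big_split_ord /= [X in _ * X]big_pred0 ?mulr1.
    by apply: eq_bigl => k; rewrite inE /= ltn_ord.
  by move=> k; rewrite inE /= ltnNge leq_addr.
rewrite big_split_ord /= [X in X * _]big_pred0 ?mul1r.
  by apply: eq_bigl => k; rewrite inE /= leq_addr.
by move=> k; rewrite inE /= leqNgt ltn_ord.
Qed.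

Lemma rho_sum (g : 'I_r -> X -> A) :
  rho (\prod_(k < n) \sum_(j < r) g j (lshift m k))
      (\prod_(k < m) \sum_(j < r) g j (rshift n k)) =
  \sum_(f : {ffun X -> 'I_r}) corr (fun x => g (f x) x) [set: X].
Proof.
rewrite !bigA_distr_bigA linear_sumlz; under eq_bigr do rewrite linear_sumr.
rewrite pair_big /=.
pose h (f : {ffun X -> 'I_r}) : {ffun 'I_n -> 'I_r} * {ffun 'I_m -> 'I_r} :=
  ([ffun k => f (lshift m k)], [ffun k => f (rshift n k)]).
pose h' (p : {ffun 'I_n -> 'I_r} * {ffun 'I_m -> 'I_r}) : {ffun X -> 'I_r} :=
  [ffun x => match split x with inl k => p.1 k | inr k => p.2 k end].
rewrite (reindex_onto h h') /=; last first.
  move=> [f1 f2] _; congr (_, _); apply/ffunP => k; rewrite !ffunE.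
    by rewrite (unsplitK (inl k)).
  by rewrite (unsplitK (inr k)).
apply: eq_big => [f|f _].
  apply/eqP/ffunP => x; rewrite ffunE /h /=; case: splitP => k xk.
    by rewrite ffunE; congr (f _); apply: val_inj.
  by rewrite ffunE; congr (f _); apply: val_inj.
rewrite corr_setT; congr (rho _ _); apply: eq_bigr => k _; by rewrite ffunE.
Qed.

End FullSum.

Local Open Scope ring_scope.
Local Open Scope classical_set_scope.
Local Open Scope complex_scope.
Theorem theorem6p9 (R : realType)
    (A : nat -> second_order_space R)
    (B : forall N : nat, 'I_N -> {pred A N})
    (T : Type) (q : forall N : nat, 'I_N -> T -> A N)
    (psi1 : seq T -> R[i]^o) (psi2 : seq T -> seq T -> R[i]^o)
    (B_subalg : forall (N : nat) (i : 'I_N), GRing.subalg_closed (B N i))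
    (B_free : forall N : nat, free_second_order (B N))
    (q_in : forall (N : nat) (i : 'I_N) (t : T), q N i t \in B N i)
    (phi_invariant : forall (N : nat) (pi : {perm 'I_N}) (n : nat)
        (t : 'I_n -> T) (i : 'I_n -> 'I_N), (0 < n)%N ->
      phi (\prod_(k < n) q N (i k) (t k)) =
      phi (\prod_(k < n) q N (pi (i k)) (t k)))
    (rho_invariant : forall (N : nat) (pi : {perm 'I_N}) (n m : nat)
        (t : 'I_(n + m) -> T) (i : 'I_(n + m) -> 'I_N),
        (0 < n)%N -> (0 < m)%N ->
      rho (\prod_(k < n) q N (i (lshift m k)) (t (lshift m k)))
          (\prod_(k < m) q N (i (rshift n k)) (t (rshift n k))) =
      rho (\prod_(k < n) q N (pi (i (lshift m k))) (t (lshift m k)))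
          (\prod_(k < m) q N (pi (i (rshift n k))) (t (rshift n k))))
    (phi_limit : forall (s : seq T) (i : forall N : nat, 'I_N.+1),
        (0 < size s)%N ->
      (fun N : nat =>
         N.+1%:R * phi (\prod_(x <- s) q N.+1 (i N) x) : R[i]^o) @ \oo
        --> psi1 s)
    (rho_limit : forall (s s' : seq T) (i : forall N : nat, 'I_N.+1),
        (0 < size s)%N -> (0 < size s')%N ->
      (fun N : nat =>
         N.+1%:R * rho (\prod_(x <- s) q N.+1 (i N) x)
                       (\prod_(x <- s') q N.+1 (i N) x) : R[i]^o) @ \oo
        --> psi2 s s')
    (n m : nat) (n_gt0 : (0 < n)%N) (m_gt0 : (0 < m)%N)
    (t : 'I_(n + m) -> T) :
  let S (N : nat) (x : T) : A N := \sum_(i < N) q N i x in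
  (fun N : nat =>
     rho (\prod_(k < n) S N (t (lshift m k)))
         (\prod_(k < m) S N (t (rshift n k))) : R[i]^o) @ \oo
    --> (\sum_(sigma in NC n m) psi_partition psi1 psi2 t sigma : R[i]^o).
Proof.
have phi_lim (s : seq T) (i : forall N : nat, 'I_N.+1) : (0 < size s)%N ->
    (fun N => N.+1%:R * phi (\prod_(x <- s) q N.+1 (i N) x)) ~> psi1 s.
  by move=> s0; split; apply: phi_limit.
have rho_lim (s s' : seq T) (i : forall N : nat, 'I_N.+1) :
    (0 < size s)%N -> (0 < size s')%N ->
    (fun N => N.+1%:R * rho (\prod_(x <- s) q N.+1 (i N) x)
                            (\prod_(x <- s') q N.+1 (i N) x)) ~> psi2 s s'.
  by move=> s0 s0'; split; apply: rho_limit.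
(* The limits in the hypotheses are those of the sequence shifted by one. *)
move=> S; rewrite -cvg_shiftS /=.
(* A representative of the index functions with kernel [sigma], injective on
   the blocks as soon as [#|sigma| <= N]. *)
pose ix (sigma : {set {set 'I_(n + m)}}) N (x : 'I_(n + m)) : 'I_N.+1 :=
  inord (index (pblock sigma x) (enum sigma)).
have ix_inj sigma N x y : partition sigma [set: 'I_(n + m)]%SET ->
    (#|sigma| <= N)%N ->
    (ix sigma N x == ix sigma N y) = (pblock sigma x == pblock sigma y).
  case/and3P=> /eqP cov _ _ sN.
  have inS z : pblock sigma z \in enum sigma by rewrite mem_enum pblock_mem // cov.
  have lt z : (index (pblock sigma z) (enum sigma) < N.+1)%N.
    by apply: leq_trans (leq_trans sN _); rewrite // cardE index_mem.
  apply/eqP/eqP => [/(congr1 val)|e]; last by rewrite /ix e.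
  rewrite /= !inordK // => e.
  by rewrite -(nth_index finset.set0 (inS x)) e nth_index.
pose c sigma N := corr (fun x => q N.+1 (ix sigma N x) (t x)) [set: 'I_(n + m)]%SET.
have c_lim sigma : partition sigma [set: 'I_(n + m)]%SET ->
    (fun N => N.+1%:R ^+ #|sigma| * c sigma N) ~>
    (if annular sigma then psi_partition psi1 psi2 t sigma else 0).
  move=> ps; rewrite -{1 3 4}(classes_pblock ps).
  apply: (corr_limit B_subalg B_free q_in phi_lim rho_lim t
    (lshift m (Ordinal n_gt0)) (N0 := #|sigma|)).
  - by move=> N x y e; rewrite /ix e.
  - by move=> N x y; apply: ix_inj.
have term_lim sigma : partition sigma [set: 'I_(n + m)]%SET ->
    (fun N => (N.+1 ^_ #|sigma|)%:R * c sigma N) ~>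
    (if annular sigma then psi_partition psi1 psi2 t sigma else 0).
  move=> ps; rewrite -[X in _ ~> X]mul1r.
  apply: (cvgi_ext (cvgi_mul (ffact_limit R #|sigma|) (c_lim _ ps))) => N.
  rewrite mulrA; congr (_ * _); rewrite -mulrA -exprMn mulVf ?expr1n ?mulr1 //.
  by rewrite pnatr_eq0.
have [//] : (fun N => rho (\prod_(k < n) S N.+1 (t (lshift m k)))
    (\prod_(k < m) S N.+1 (t (rshift n k)))) ~>
    \sum_(sigma in NC n m) psi_partition psi1 psi2 t sigma.
rewrite (eq_bigl (fun sigma => partition sigma [set: 'I_(n + m)]%SET && annular sigma));
  last by move=> sigma; rewrite inE.
rewrite big_mkcondr /=.
apply: (cvgi_near (N0 := #|[set: {set 'I_(n + m)}]%SET|) (cvgi_sum _ term_lim)) => N NN.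
rewrite (rho_sum (fun j x => q N.+1 j (t x))).
rewrite (partition_big
  (fun f : {ffun 'I_(n + m) -> 'I_N.+1} => classes f [set: 'I_(n + m)]%SET)
  (fun sigma => partition sigma [set: 'I_(n + m)]%SET)) /=; last first.
  by move=> f _; apply: preim_partitionP.
apply: eq_bigr => sigma ps.
have sN : (#|sigma| <= N)%N.
  by apply: leq_trans NN; apply: subset_leq_card; apply: subsetT.
rewrite (eq_bigr (fun=> c sigma N)).
  rewrite sumr_const (eq_card (B := [set f : {ffun 'I_(n + m) -> 'I_N.+1} |
    classes f [set: 'I_(n + m)]%SET == sigma]%SET)).
    by rewrite card_kernel // card_ord mulr_natl.
  by move=> f; rewrite inE.
move=> f /eqP kf.
have [pi fpi] : exists pi : {perm 'I_N.+1}, forall x, f x = pi (ix sigma N x).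
  apply: same_kernel_perm => x y; rewrite ix_inj //.
  by move: x y; apply/kernel_classes; rewrite kf classes_pblock.
rewrite /c !corr_setT.
rewrite (rho_invariant _ pi _ _ t (ix sigma N)) //.
by congr (rho _ _); apply: eq_bigr => k _; rewrite fpi.
Qed.
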